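(* Let $(M^n,g,[\phi],\lambda=0)$ be a weighted conformal class of manifolds with density. For every $k\in\mathbb N$ there is a formally self-adjoint conformally invariant operator $$L_{2k,\phi}:\mathcal E[-1/2]\to\mathcal E[-1/2]$$ with leading term $\Delta_\phi^k$.
   Context: $(M^n,g)$ is a Riemannian manifold, $\phi\in C^\infty(M)$, and $\mathcal C=[\phi]=\{\phi+\omega:\omega\in C^\infty(M)\}$ is the weighted conformal class (the metric $g$ is unchanged). The space of conformal densities of weight $w$ is $\mathcal E[w]=\{f:\mathcal C\to C^\infty(M)\mid f(\phi+v)(x)=e^{wv}f(\phi)(x)\}$ (for $v\in C^\infty(M)$, with $v$ evaluated at $x$). Choosing a representative $\phi$ identifies $\mathcal E[w]$ with $C^\infty(M)$. $\Delta_\phi=\Delta-\nabla\phi\cdot\nabla$ is the weighted Laplacian, and formal self-adjointness is with respect to the weighted measure $e^{-\phi}\mathrm{dvol}_g$.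
   Formalization: The sign in the law of conformal densities is changed to f(φ−v)=e^{wv}f(φ) (equivalently weight +1/2); with f(φ+v)=e^{wv}f(φ) and weight −1/2, self-adjointness in every representative forces order 0, so the claim fails for k,n≥1. *)

(* Defs.v *)
From mathcomp Require Import all_boot all_order all_algebra.
From mathcomp Require Import all_classical all_reals all_analysis.
From mathcomp Require Import measurable_realfun.

Set Implicit Arguments.
Unset Strict Implicit.
Unset Printing Implicit Defensive.

Import Order.TTheory GRing.Theory Num.Theory.
Import numFieldNormedType.Exports.

Local Open Scope classical_set_scope.
Local Open Scope ring_scope.

(** * Calculus on open subsets of R^n *)

Definition partial (R : realType) (n : nat) (i : 'I_n) (f : 'rV[R]_n -> R) :
    'rV[R]_n -> R :=
  fun y => 'D_(delta_mx ord0 i) f y.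

Definition partials (R : realType) (n : nat) (s : seq 'I_n)
    (f : 'rV[R]_n -> R) : 'rV[R]_n -> R :=
  foldr (@partial R n) f s.

(* C^oo on U; only used for open U, so the values of f off U are irrelevant. *)
Definition smooth_on (R : realType) (n : nat) (U : set 'rV[R]_n)
    (f : 'rV[R]_n -> R) : Prop :=
  forall (s : seq 'I_n) (y : 'rV[R]_n), U y ->
    {for y, continuous (partials s f)} /\
    forall i : 'I_n, derivable (partials s f) y (delta_mx ord0 i).

(* Lebesgue integral over R^n of a nonnegative Borel function, as an iterated
   integral (Tonelli). *)
Fixpoint integral_Rn (R : realType) (n : nat) :
    ('rV[R]_n -> \bar R) -> \bar R :=
  match n with
  | 0 => fun f => f 0
  | n'.+1 => fun f => (\int[@lebesgue_measure R]_t
      integral_Rn (fun y : 'rV[R]_n' => f (row_mx (t%:M : 'rV[R]_1) y)))%E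
  end.

(** * Smooth manifolds *)

Record chart (R : realType) (n : nat) (M : topologicalType) := Chart {
  chart_dom : set M;
  chart_map :> M -> 'rV[R]_n;
  chart_inv : 'rV[R]_n -> M;
  chart_dom_open : open chart_dom;
  chart_img_open : open (chart_map @` chart_dom);
  chart_mapK : forall x, chart_dom x -> chart_inv (chart_map x) = x;
  chart_map_continuous : {within chart_dom, continuous chart_map};
  chart_inv_continuous :
    {within chart_map @` chart_dom, continuous chart_inv} }.

Definition chart_img (R : realType) (n : nat) (M : topologicalType)
    (c : chart R n M) : set 'rV[R]_n :=
  c @` chart_dom c.

Definition transition (R : realType) (n : nat) (M : topologicalType)
    (c d : chart R n M) : 'rV[R]_n -> 'rV[R]_n :=
  d \o chart_inv c.

Record smooth_manifold (R : realType) (n : nat) := SmoothManifold {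
  manifold_space :> ptopologicalType;
  manifold_hausdorff : hausdorff_space manifold_space;
  manifold_second_countable : @second_countable manifold_space;
  atlas : set (chart R n manifold_space);
  (* a chosen chart around each point, so that the atlas covers *)
  chart_at : manifold_space -> chart R n manifold_space;
  chart_at_atlas : forall x, atlas (chart_at x);
  chart_at_dom : forall x, chart_dom (chart_at x) x;
  atlas_compatible : forall c d, atlas c -> atlas d -> forall j : 'I_n,
    smooth_on (c @` (chart_dom c `&` chart_dom d))
      (fun y => transition c d y ord0 j) }.

Definition smooth_fun (R : realType) (n : nat) (M : smooth_manifold R n)
    (u : M -> R) : Prop :=
  forall c, atlas c -> smooth_on (chart_img c) (u \o chart_inv c).

Definition compactly_supported (R : realType) (n : nat)
    (M : smooth_manifold R n) (u : M -> R) : Prop :=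
  compact (closure [set x | u x != 0]).

(* T agrees on C^oo(M) with a linear differential operator with smooth
   coefficients which only involves derivatives of order < m. *)
Definition diffop_order_lt (R : realType) (n : nat) (M : smooth_manifold R n)
    (m : nat) (T : (M -> R) -> (M -> R)) : Prop :=
  forall c, atlas c ->
    exists a : seq 'I_n -> 'rV[R]_n -> R,
      (forall s, smooth_on (chart_img c) (a s)) /\
      forall u, smooth_fun u -> forall y, chart_img c y ->
        T u (chart_inv c y) =
        \sum_(j < m) \sum_(s : j.-tuple 'I_n)
           a s y * partials s (u \o chart_inv c) y.

(** * Riemannian geometry *)

(* [gram c y] is the matrix (g_ij) in the chart c at the point of coordinates
   y.  Tangent vectors are row vectors and 'D_v f = v *m 'J f, which fixes the
   side of the transposes in [gram_change]. *)
Record riemannian_metric (R : realType) (n : nat) (M : smooth_manifold R n) :=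
  RiemannianMetric {
  gram : chart R n M -> 'rV[R]_n -> 'M[R]_n;
  gram_smooth : forall c, atlas c -> forall i j : 'I_n,
    smooth_on (chart_img c) (fun y => gram c y i j);
  gram_sym : forall c, atlas c -> forall y, chart_img c y ->
    (gram c y)^T = gram c y;
  gram_pos : forall c, atlas c -> forall y, chart_img c y ->
    forall v : 'rV[R]_n, v != 0 -> 0 < (v *m gram c y *m v^T) ord0 ord0;
  gram_change : forall c d, atlas c -> atlas d ->
    forall x, chart_dom c x -> chart_dom d x ->
    gram c (c x) = 'J (transition c d) (c x) *m gram d (d x)
                     *m ('J (transition c d) (c x))^T }.

Definition vol_density (R : realType) (n : nat) (M : smooth_manifold R n)
    (g : riemannian_metric M) (c : chart R n M) (y : 'rV[R]_n) : R :=
  Num.sqrt (\det (gram g c y)).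

(* div (grad u) = |g|^(-1/2) d_i (|g|^(1/2) g^ij d_j u); the value does not
   depend on the chart around x. *)
Definition laplacian (R : realType) (n : nat) (M : smooth_manifold R n)
    (g : riemannian_metric M) (u : M -> R) : M -> R :=
  fun x =>
    let c := chart_at x in
    (vol_density g c (c x))^-1 *
    \sum_(i < n) partial i (fun y => vol_density g c y *
       \sum_(j < n) invmx (gram g c y) i j * partial j (u \o chart_inv c) y)
      (c x).

Definition grad_inner (R : realType) (n : nat) (M : smooth_manifold R n)
    (g : riemannian_metric M) (u v : M -> R) : M -> R :=
  fun x =>
    let c := chart_at x in
    \sum_(i < n) \sum_(j < n) invmx (gram g c (c x)) i j *
      partial i (u \o chart_inv c) (c x) * partial j (v \o chart_inv c) (c x).

Definition weighted_laplacian (R : realType) (n : nat)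
    (M : smooth_manifold R n) (g : riemannian_metric M) (phi u : M -> R) :
    M -> R :=
  fun x => laplacian g u x - grad_inner g phi u x.

Notation borel T := (g_sigma_algebraType (@open T)).

(* mu = dvol_g.  On a second countable manifold there is exactly one such
   Borel measure. *)
Definition is_riemannian_volume (R : realType) (n : nat)
    (M : smooth_manifold R n) (g : riemannian_metric M)
    (mu : {measure set (borel M) -> \bar R}) : Prop :=
  forall c, atlas c -> forall f : borel M -> \bar R,
    measurable_fun [set: borel M] f -> (forall x, 0 <= f x)%E ->
    (\int[mu]_(x in (chart_dom c : set (borel M))) f x =
     integral_Rn ((fun y => (vol_density g c y)%:E * f (chart_inv c y))
                    \_ (chart_img c)))%E.

Definition formally_self_adjoint (R : realType) (n : nat)
    (M : smooth_manifold R n) (mu : {measure set (borel M) -> \bar R})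
    (phi : M -> R) (P : (M -> R) -> (M -> R)) : Prop :=
  forall u v : M -> R,
    smooth_fun u -> compactly_supported u ->
    smooth_fun v -> compactly_supported v ->
    (\int[mu]_x (P u x * v x * expR (- phi x))%:E =
     \int[mu]_x (u x * P v x * expR (- phi x))%:E)%E.

(** * Weighted conformal classes and densities *)

Definition weighted_class (R : realType) (n : nat) (M : smooth_manifold R n)
    (phi : M -> R) : set (M -> R) :=
  [set psi | exists2 omega : M -> R, smooth_fun omega & psi = phi \+ omega].

(* Sign convention: v is the logarithm of the factor by which the weighted
   measure is rescaled, e^(-(psi - v)) dvol = e^v e^(-psi) dvol, and densities
   of weight w are multiplied by e^(wv) under this change.  With the rule
   f (psi + v) = e^(wv) f psi instead, e^(-psi) dvol would itself have weight
   -1; the operators P_psi on functions representing an operator on densities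
   of weight -1/2 would satisfy P_(psi+v) = e^(-v/2) P_psi e^(v/2), and formal
   self-adjointness with respect to e^(-psi) dvol for all psi would make P_psi
   commute with multiplication by every e^(2v), hence be of order zero. *)
Record density (R : realType) (n : nat) (M : smooth_manifold R n)
    (phi : M -> R) (w : R) := Density {
  density_val :> weighted_class phi -> M -> R;
  density_smooth : forall psi, smooth_fun (density_val psi);
  density_law : forall (psi psi' : weighted_class phi) (v : M -> R),
    smooth_fun v -> val psi' = val psi \- v ->
    forall x, density_val psi' x = expR (w * v x) * density_val psi x }.

(* P is L under the identification f |-> f psi of densities with C^oo(M). *)
Definition represents (R : realType) (n : nat) (M : smooth_manifold R n)
    (phi : M -> R) (w1 w2 : R) (L : density phi w1 -> density phi w2)
    (psi : weighted_class phi) (P : (M -> R) -> (M -> R)) : Prop :=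
  forall f : density phi w1, L f psi = P (f psi).

(* P = D + lower order terms, for D of order m *)
Definition has_leading_term (R : realType) (n : nat) (M : smooth_manifold R n)
    (m : nat) (P D : (M -> R) -> (M -> R)) : Prop :=
  diffop_order_lt m (fun u => P u \- D u).

(* Main.v *)
(* Densities of weight -1/2 are half-densities: f psi = e^(psi/2) F where the
   function F does not depend on psi, and
     int (f psi) (h psi) e^(-psi) dvol = int F H dvol.
   Hence every operator on functions which is formally self-adjoint for dvol
   gives a conformally invariant one which is formally self-adjoint for
   e^(-psi) dvol, and we take F |-> Delta^k F.  For the representative psi this
   is the k-th power of
     e^(psi/2) Delta e^(-psi/2) = Delta_psi + q,    q = e^(psi/2) Delta (e^(-psi/2)),
   so its leading term is Delta_psi^k.

   Self-adjointness of Delta is Green's formula.  In one chart it says that the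
   integral of a partial derivative over R^n vanishes; a partition of unity makes
   it global, which needs the coordinate formula of Delta to be independent of
   the chart.  That independence follows from Green's formula itself: div grad u
   is determined by its integrals against bump functions, because the gradient
   term is visibly invariant and the measure is the same in all charts. *)

Require Import Defs.
From HB Require Import structures.
From mathcomp Require Import all_boot all_order all_algebra.
From mathcomp Require Import all_classical all_reals all_analysis.
From mathcomp Require Import measurable_realfun.
From mathcomp Require Import ring lra.
Import Order.TTheory GRing.Theory Num.Theory.
Import numFieldNormedType.Exports.
Set Implicit Arguments.
Unset Strict Implicit.
Unset Printing Implicit Defensive.
Local Open Scope classical_set_scope.
Local Open Scope ring_scope.

(** * Calculus in several variables *)

(** [laplacian] is computed at each x in the chart [chart_at x], which varies with x without any
    continuity. So even the continuity of [laplacian g u] is not visible from its definition, and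
    independence of the chart is needed before the operators can map densities to densities. A
    direct verification would involve second derivatives of the transition maps and the derivative
    of a determinant; testing against bumps involves only first derivatives of the transitions.

    Test functions enter Green's formula through one derivative, so regularity is graded by an order
    m ([Ck]), and products with C^1 cut-offs stay within the calculus. Since [smooth_on] is about
    iterated partial derivatives, the chain rule for transitions first requires total
    differentiability of C^1 functions. *)

Section Slices.
Variables (R : realType) (V : normedModType R).

Lemma is_derive_slice (f : V -> R) (p v : V) (t : R) :
  derivable f (t *: v + p) v ->
  is_derive t 1 (fun s : R => f (s *: v + p)) ('D_v f (t *: v + p)).
Proof.
have E : (fun h : R => h^-1 *: (((fun s : R => f (s *: v + p)) \o shift t) (h *: 1) -
            f (t *: v + p))) =
         (fun h : R => h^-1 *: ((f \o shift (t *: v + p)) (h *: v) - f (t *: v + p))).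
  by apply/funext => h /=; rewrite [_%:A]mulr1 scalerDl addrA.
move=> df; apply: DeriveDef; first by rewrite /derivable E.
by rewrite /derive E.
Qed.

(** Only derivability along v is available for f, not differentiability; restricting f to the line
    through y reduces the claim to the chain rule in one variable. *)
Lemma is_derive_comp1 (f : V -> R) (h : R -> R) (y v : V) (dh : R) :
  derivable f y v -> is_derive (f y) 1 h dh ->
  is_derive y v (h \o f) (dh * 'D_v f y).
Proof.
move=> df [dh1 dh2].
pose g (s : R) := f (s *: v + y).
have y0 : 0 *: v + y = y by rewrite scale0r add0r.
have dg : is_derive (0 : R) 1 g ('D_v f y).
  by have := @is_derive_slice f y v 0; rewrite y0; apply.
have g0 : g 0 = f y by rewrite /g y0.
have dh0 : derivable h (g 0) 1 by rewrite g0.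
have dhg : derivable (h \o g) 0 1.
  apply/derivable1_diffP/differentiable_comp; last exact/derivable1_diffP.
  by apply/derivable1_diffP; case: dg.
have dhf : derivable (h \o f) y v by apply/derivable1P.
split=> //.
have := @is_derive_slice (h \o f) y v 0; rewrite y0 => /(_ dhf)[_ <-].
transitivity (derive1 (h \o g) 0); first by rewrite derive1E.
have [dg1 dg2] := dg.
by rewrite (derive1_comp dg1 dh0) !derive1E g0 dh2 dg2.
Qed.

End Slices.

Section Mean.
Variables (R : realType).

Lemma ler_dist_affine (F dF : R -> R) (a c e : R) :
  (forall t : R, `|t| <= `|a| -> is_derive t (1:R) F (dF t)) ->
  (forall t : R, `|t| <= `|a| -> `|dF t - c| <= e) ->
  `|F a - F 0 - a * c| <= e * `|a|.
Proof.
move=> HF HdF.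
(* Rescaling to the parameter interval [0, 1] treats positive and negative a at once. *)
pose G (s : R) := F (s * a).
have dG (s : R) : 0 <= s <= 1 -> is_derive s (1:R) G (dF (s * a) * a).
  move=> /andP[s0 s1].
  have sa : `|s * a| <= `|a| by rewrite normrM ger0_norm// ler_piMl.
  have [d1 d2] : is_derive s (1 : R) (fun u : R => u * a) a.
    have -> : (fun u : R => u * a) = a \*: id.
      by apply/funext => u /=; rewrite mulrC.
    apply: is_derive_eq; exact: mulr1.
  have := @is_derive_comp1 R R (fun u => u * a) F s 1 _ d1 (HF _ sa).
  by rewrite d2.
have [] := @MVT R G (fun s => dF (s * a) * a) 0 1 ltr01.
- by move=> s; rewrite in_itv/= => /andP[s0 s1]; apply: dG; rewrite !ltW.
- apply: derivable_within_continuous => s; rewrite in_itv/= => s01.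
  by have [] := dG s s01.
move=> s; rewrite in_itv/= => /andP[s0 s1].
rewrite /G mul1r mul0r subr0 mulr1 => ->.
rewrite [a * c]mulrC -mulrBl normrM ler_wpM2r//; apply: HdF.
by rewrite normrM ger0_norm ?ler_piMl// ltW.
Qed.

End Mean.

Section Differentiability.
Variables (R : realType) (n : nat).
Local Notation V := 'rV[R]_n.

Definition basis_vec (i : 'I_n) : V := delta_mx ord0 i.

(** The points [row_take k h] for k from 0 to n are the corners of a path from 0 to h parallel to
    the axes. Matrices carry the maximum norm, so the path stays in the ball of radius [|h|]. *)
Definition row_take (k : nat) (h : V) : V :=
  \row_i (if (i < k)%N then h ord0 i else 0).

Lemma row_norm_le (h : V) (r : R) : 0 <= r ->
  (forall i, `|h ord0 i| <= r) -> `|h| <= r.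
Proof.
move=> r0 H; rewrite [leLHS]/Num.Def.normr /= mx_normrE; apply: bigmax_le => // -[i j] _ /=.
by rewrite (ord1 i).
Qed.

Lemma coord_norm_le (h : V) i : `|h ord0 i| <= `|h|.
Proof. by rewrite [leRHS]/Num.Def.normr /= mx_normrE; apply: (le_bigmax _ _ (ord0, i)). Qed.

Lemma row_takeS (h : V) (k : 'I_n) :
  row_take k.+1 h = h ord0 k *: basis_vec k + row_take k h.
Proof.
apply/rowP => j; rewrite !mxE eqxx/= ltnS.
have [->|jk] := eqVneq j k; first by rewrite leqnn ltnn mulr1 addr0.
rewrite mulr0 add0r leq_eqVlt.
by have /negPf -> : nat_of_ord j != nat_of_ord k by [].
Qed.

Lemma row_take_norm (h : V) (k : 'I_n) (t : R) : `|t| <= `|h ord0 k| ->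
  `|t *: basis_vec k + row_take k h| <= `|h|.
Proof.
move=> th; apply: row_norm_le => // j; rewrite !mxE eqxx/=.
have [->|jk] := eqVneq j k.
  by rewrite ltnn mulr1 addr0 (le_trans th)// coord_norm_le.
rewrite mulr0 add0r; case: ifP => _; first exact: coord_norm_le.
by rewrite normr0.
Qed.

(* Telescope along the coordinates and apply the mean value theorem on each
   segment. *)
Lemma partials_bound (U : set V) (f : V -> R) (y : V) : open U -> U y ->
  (forall i z, U z -> derivable f z (basis_vec i)) ->
  (forall i, {for y, continuous (partial i f)}) ->
  forall e : R, 0 < e -> \forall h \near (0 : V),
    `|f (h + y) - f y - \sum_i h ord0 i * partial i f y| <= e * `|h|.
Proof.
move=> oU Uy df cf e e0.
(* Each of the n coordinates contributes at most [e' * |h|]; dividing by n + 1 instead of n covers n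
   = 0. *)
pose e' := e / n.+1%:R.
have e'0 : 0 < e' by rewrite divr_gt0.
have near_i i : \forall z \near y, U z /\ `|partial i f z - partial i f y| <= e'.
  apply: filterI; first exact: open_nbhs_nbhs.
  by move: (cf i) => /cvgrPdist_le/(_ _ e'0); apply: filterS => z; rewrite distrC.
have nf : \forall z \near y, forall i, U z /\ `|partial i f z - partial i f y| <= e'.
  exact: (filter_forall (@nbhs_filter V y) near_i).
move/nbhs_ballP: nf => [d /= d0 Hd].
apply/nbhs_ballP; exists d => //= h; rewrite -ball_normE /= sub0r normrN => hd.
have Hh z : `|z| <= `|h| -> forall i, U (z + y) /\ `|partial i f (z + y) - partial i f y| <= e'.
  move=> zh; apply: Hd; rewrite -ball_normE /= opprD addrC subrK normrN.
  exact: le_lt_trans hd.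
have tn : row_take n h = h by apply/rowP => j; rewrite mxE ltn_ord.
have t0 : row_take 0 h = 0 by apply/rowP => j; rewrite !mxE ltn0.
have -> : f (h + y) - f y =
    \sum_(i < n) (f (row_take i.+1 h + y) - f (row_take i h + y)).
  rewrite -(big_mkord xpredT (fun i => f (row_take i.+1 h + y) - f (row_take i h + y))).
  by rewrite telescope_sumr// tn t0 add0r.
rewrite -sumrB (le_trans (ler_norm_sum _ _ _))//.
apply: (@le_trans _ _ (\sum_(i < n) e' * `|h|)); last first.
  rewrite sumr_const card_ord -mulr_natr mulrAC ler_wpM2r// /e'.
  by rewrite mulrAC -mulrA ler_piMr ?(ltW e0)// ler_pdivrMr// mul1r ler_nat.
apply: ler_sum => k _.
pose p := row_take k h + y.
pose F (t : R) := f (t *: basis_vec k + p).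
have Fh : F (h ord0 k) = f (row_take k.+1 h + y) by rewrite /F /p row_takeS addrA.
have F0 : F 0 = f (row_take k h + y) by rewrite /F scale0r add0r.
rewrite -Fh -F0.
have seg t : `|t| <= `|h ord0 k| ->
    U (t *: basis_vec k + p) /\
    `|partial k f (t *: basis_vec k + p) - partial k f y| <= e'.
  by move=> th; rewrite /p addrA; apply: Hh; exact: row_take_norm.
apply: (le_trans (@ler_dist_affine R F (fun t => partial k f (t *: basis_vec k + p)) _ _ e' _ _)).
- by move=> t th; apply: is_derive_slice; apply: df; have [] := seg t th.
- by move=> t th; have [] := seg t th.
- by rewrite ler_wpM2l ?(ltW e'0)// coord_norm_le.
Qed.

Lemma continuous_at_sum (T : topologicalType) (I : Type) (r : seq I) (P : pred I)
    (F : I -> T -> R) (y : T) :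
  (forall i, P i -> {for y, continuous (F i)}) ->
  {for y, continuous (fun z => \sum_(i <- r | P i) F i z)}.
Proof.
move=> H; elim: r => [|i r IH].
  have -> : (fun z => \sum_(i <- [::] | P i) F i z) = cst 0 by apply/funext => z; rewrite big_nil.
  exact: cvg_cst.
have -> : (fun z => \sum_(i <- i :: r | P i) F i z) =
  if P i then fun z => F i z + \sum_(i <- r | P i) F i z else fun z => \sum_(i <- r | P i) F i z.
  by case: ifP => Pi; apply/funext => z; rewrite big_cons Pi.
case: ifP => // Pi; apply: cvgD => //; exact: H.
Qed.

(** The differential has to be the sum of the partial derivatives weighted by the coordinates, and
    [partials_bound] says that its remainder is o(h). *)
Lemma partials_differentiable (U : set V) (f : V -> R) (y : V) : open U -> U y ->
  (forall i z, U z -> derivable f z (basis_vec i)) ->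
  (forall i, {for y, continuous (partial i f)}) ->
  differentiable f y.
Proof.
move=> oU Uy df cf.
pose L (h : V) : R := \sum_i h ord0 i * partial i f y.
have L_lin : linear L.
  move=> a u v; rewrite /L scaler_sumr -big_split; apply: eq_bigr => i _ /=.
  by rewrite !mxE mulrDl scalerAl.
pose LL : {linear V -> R} := HB.pack L (GRing.isLinear.Build _ _ _ _ _ L_lin).
have cL : continuous LL.
  move=> z; apply: (@continuous_at_sum V _ (index_enum 'I_n) xpredT
    (fun i h => h ord0 i * partial i f y)) => i _.
  apply: continuousM; first exact: coord_continuous.
  exact: cst_continuous.
have bound (e : R) : 0 < e -> \forall h \near (0 : V),
    `|(f \o shift y - (cst (f y) + L)) h| <= e * `|h|.
  move=> e0; have := partials_bound oU Uy df cf e0.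
  by apply: filterS => h /= H; rewrite opprD addrA; exact: H.
have dfE : 'd f y = LL :> (V -> R).
  by apply: diff_unique cL _; apply/eqaddoP => e; exact: bound.
by apply/diff_locallyP; rewrite dfE; split => //; apply/eqaddoP => e; exact: bound.
Qed.

Lemma diff_partial (f : V -> R) (y v : V) : differentiable f y ->
  'D_v f y = \sum_i v ord0 i * partial i f y.
Proof.
move=> df; rewrite deriveE// {1}(row_sum_delta v) linear_sum; apply: eq_bigr => i _.
by rewrite linearZ /= /partial deriveE.
Qed.

End Differentiability.

(** * Regularity of finite order *)

Section Ck.
Variables (R : realType) (n : nat).
Local Notation V := 'rV[R]_n.
Implicit Types (U : set V) (f g : V -> R) (y : V) (i : 'I_n) (m : nat).

(** Unlike in [smooth_on], the recursion removes the derivative that is applied to f first, so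
    closure under products and compositions follows by induction on m. *)
Fixpoint Ck_at m f y : Prop :=
  {for y, continuous f} /\
  match m with
  | 0 => True
  | m'.+1 => forall i, derivable f y (basis_vec R i) /\ Ck_at m' (partial i f) y
  end.

Definition Ck m U f : Prop := forall y, U y -> Ck_at m f y.

Lemma partials_rcons s i f : partials (rcons s i) f = partials s (partial i f).
Proof. by rewrite /partials -cats1 foldr_cat. Qed.

Lemma smooth_onP U f : smooth_on U f <-> forall m, Ck m U f.
Proof.
split=> [sf m|H s].
  elim: m f sf => [|m IH] f sf y Uy; split => //; first by have [] := sf [::] y Uy.
    by have [] := sf [::] y Uy.
  move=> i; split; first by have [_] := sf [::] y Uy; apply.
  by apply: IH => // s z Uz; rewrite -partials_rcons; exact: sf.
(* Induction from the end of the word: its last letter is the derivative taken first, the one that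
   [Ck_at] removes. *)
elim/last_ind: s f H => [|s i IH] f H y Uy.
  have [cf H1] := H 1 y Uy.
  by split => // i; have [] := H1 i.
rewrite partials_rcons; apply: IH => // m z Uz.
by have [_ /(_ i)[]] := H m.+1 z Uz.
Qed.

Lemma Ck_cont m U f y : Ck m U f -> U y -> {for y, continuous f}.
Proof. by move=> H /H; case: m H => [|m] _ []. Qed.

Lemma Ck_derivable m U f y i : Ck m.+1 U f -> U y -> derivable f y (basis_vec R i).
Proof. by move=> H /H[_ /(_ i)[]]. Qed.

Lemma Ck_partial m U f i : Ck m.+1 U f -> Ck m U (partial i f).
Proof. by move=> H y /H[_ /(_ i)[]]. Qed.

Lemma CkS m U f : (forall y, U y -> {for y, continuous f}) ->
  (forall i y, U y -> derivable f y (basis_vec R i)) ->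
  (forall i, Ck m U (partial i f)) -> Ck m.+1 U f.
Proof. by move=> cf df pf y Uy; split; [exact: cf|split; [exact: df|exact: pf]]. Qed.

Lemma Ck_pred m U f : Ck m.+1 U f -> Ck m U f.
Proof.
elim: m f => [|m IH] f H; first by move=> y /H[].
apply: CkS => [y|i y|i]; [exact: Ck_cont H|exact: Ck_derivable H|].
exact/IH/Ck_partial.
Qed.

Lemma Ck_sub m U U' f : U' `<=` U -> Ck m U f -> Ck m U' f.
Proof. by move=> UU' H y /UU'/H. Qed.

Lemma near_partial i f g y : (\near y, f y = g y) ->
  \near y, partial i f y = partial i g y.
Proof.
move=> /nbhs_interior; apply: filterS => z fg.
exact: near_eq_derive.
Qed.

Lemma near_continuous (T S : topologicalType) (f g : T -> S) (y : T) :
  (\near y, f y = g y) -> {for y, continuous f} -> {for y, continuous g}.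
Proof.
move=> fg cf; rewrite /prop_for /continuous_at -(nbhs_singleton fg).
by apply: cvg_trans cf; apply: near_eq_cvg; apply: filterS fg => z ->.
Qed.

Lemma Ck_at_near m f g y : (\near y, f y = g y) -> Ck_at m f y -> Ck_at m g y.
Proof.
elim: m f g => [|m IH] f g fg [cf H]; split => //; try exact: near_continuous cf.
move=> i; have [df pf] := H i; split.
  by apply: near_eq_derivable df.
exact: IH (near_partial i fg) pf.
Qed.

Lemma near_open U f g y : open U -> U y -> (forall z, U z -> f z = g z) ->
  \near y, f y = g y.
Proof.
by move=> oU Uy fg; apply: filterS (open_nbhs_nbhs (conj oU Uy)) => z /fg.
Qed.

Lemma Ck_ext m U f g : open U -> (forall y, U y -> f y = g y) ->
  Ck m U f -> Ck m U g.
Proof. by move=> oU fg H y Uy; apply: Ck_at_near (H y Uy); exact: near_open fg. Qed.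

Lemma partial_ext U f g i y : open U -> U y -> (forall y, U y -> f y = g y) ->
  partial i f y = partial i g y.
Proof. by move=> oU Uy fg; apply: near_eq_derive; exact: near_open fg. Qed.

Lemma partial_cst i (c : R) y : partial i (fun=> c) y = 0.
Proof. exact: derive_cst. Qed.

Lemma Ck_cst m U (c : R) : Ck m U (fun=> c).
Proof.
elim: m c => [|m IH] c y Uy; split => //; try exact: cst_continuous.
move=> i; split; first exact: derivable_cst.
have -> : partial i (fun=> c) = fun=> 0 by apply/funext => z; exact: partial_cst.
exact: IH.
Qed.

Lemma partialD i f g y : derivable f y (basis_vec R i) ->
  derivable g y (basis_vec R i) ->
  partial i (fun z => f z + g z) y = partial i f y + partial i g y.
Proof. by move=> df dg; rewrite /partial -deriveD. Qed.

Lemma partialM i f g y : derivable f y (basis_vec R i) ->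
  derivable g y (basis_vec R i) ->
  partial i (fun z => f z * g z) y = f y * partial i g y + g y * partial i f y.
Proof. by move=> df dg; rewrite /partial [LHS]deriveM. Qed.

Lemma CkD m U f g : open U -> Ck m U f -> Ck m U g -> Ck m U (fun z => f z + g z).
Proof.
move=> oU; elim: m f g => [|m IH] f g cf cg.
  by move=> y Uy; split => //; apply: continuousD; [exact: Ck_cont cf Uy|exact: Ck_cont cg Uy].
apply: CkS => [y Uy|i y Uy|i].
- by apply: continuousD; [exact: Ck_cont cf Uy|exact: Ck_cont cg Uy].
- by apply: derivableD; [exact: Ck_derivable cf Uy|exact: Ck_derivable cg Uy].
- apply: (@Ck_ext _ _ (fun z => partial i f z + partial i g z)) => // [y Uy|].
    by rewrite partialD//; [exact: Ck_derivable cf Uy|exact: Ck_derivable cg Uy].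
  by apply: IH; exact: Ck_partial.
Qed.

Lemma CkM m U f g : open U -> Ck m U f -> Ck m U g -> Ck m U (fun z => f z * g z).
Proof.
move=> oU; elim: m f g => [|m IH] f g cf cg.
  by move=> y Uy; split => //; apply: continuousM; [exact: Ck_cont cf Uy|exact: Ck_cont cg Uy].
apply: CkS => [y Uy|i y Uy|i].
- by apply: continuousM; [exact: Ck_cont cf Uy|exact: Ck_cont cg Uy].
- by apply: derivableM; [exact: Ck_derivable cf Uy|exact: Ck_derivable cg Uy].
- apply: (@Ck_ext _ _ (fun z => f z * partial i g z + g z * partial i f z)) => // [y Uy|].
    by rewrite partialM//; [exact: Ck_derivable cf Uy|exact: Ck_derivable cg Uy].
  apply: CkD => //; apply: IH; by [exact: Ck_pred|exact: Ck_partial].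
Qed.

Lemma CkN m U f : open U -> Ck m U f -> Ck m U (fun z => - f z).
Proof.
move=> oU cf; apply: (@Ck_ext _ _ (fun z => -1 * f z)) => // [y _|].
  by rewrite mulN1r.
by apply: CkM => //; exact: Ck_cst.
Qed.

Lemma CkB m U f g : open U -> Ck m U f -> Ck m U g -> Ck m U (fun z => f z - g z).
Proof. by move=> oU cf cg; apply: CkD => //; exact: CkN. Qed.

Lemma Ck_sum m U (I : Type) (r : seq I) (P : pred I) (F : I -> V -> R) : open U ->
  (forall j, P j -> Ck m U (F j)) -> Ck m U (fun z => \sum_(j <- r | P j) F j z).
Proof.
move=> oU H; elim: r => [|j r IH].
  apply: (@Ck_ext _ _ (fun=> 0)) => // [y _|]; first by rewrite big_nil.
  exact: Ck_cst.
case Pj: (P j).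
  apply: (@Ck_ext _ _ (fun z => F j z + \sum_(j <- r | P j) F j z)) => // [y _|].
    by rewrite big_cons Pj.
  by apply: CkD => //; exact: H.
by apply: (@Ck_ext _ _ (fun z => \sum_(j <- r | P j) F j z)) => // y _; rewrite big_cons Pj.
Qed.

Lemma Ck_prod m U (I : Type) (r : seq I) (P : pred I) (F : I -> V -> R) : open U ->
  (forall j, P j -> Ck m U (F j)) -> Ck m U (fun z => \prod_(j <- r | P j) F j z).
Proof.
move=> oU H; elim: r => [|j r IH].
  apply: (@Ck_ext _ _ (fun=> 1)) => // [y _|]; first by rewrite big_nil.
  exact: Ck_cst.
case Pj: (P j).
  apply: (@Ck_ext _ _ (fun z => F j z * \prod_(j <- r | P j) F j z)) => // [y _|].
    by rewrite big_cons Pj.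
  by apply: CkM => //; exact: H.
by apply: (@Ck_ext _ _ (fun z => \prod_(j <- r | P j) F j z)) => // y _; rewrite big_cons Pj.
Qed.

(** Meant for h whose derivative is again an expression in h or in the argument, such as
    exponential, inverse and square root: regularity of order m then yields the hypothesis on [dh],
    and hence order m + 1. *)
Lemma Ck_chain m U f (h dh : R -> R) : open U -> Ck m.+1 U f ->
  (forall y, U y -> is_derive (f y) (1 : R) h (dh (f y))) ->
  Ck m U (fun z => dh (f z)) -> Ck m.+1 U (fun z => h (f z)).
Proof.
move=> oU cf dhf cdh.
have D i y : U y -> is_derive y (basis_vec R i) (h \o f) (dh (f y) * partial i f y).
  by move=> Uy; apply: is_derive_comp1; [exact: Ck_derivable cf Uy|exact: dhf].
apply: CkS => [y Uy|i y Uy|i].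
- apply: continuous_comp; first exact: Ck_cont cf Uy.
  apply/differentiable_continuous/derivable1_diffP.
  by have [] := dhf y Uy.
- by have [] := D i y Uy.
- apply: (@Ck_ext _ _ (fun z => dh (f z) * partial i f z)) => // [y Uy|].
    by have [_ <-] := D i y Uy.
  by apply: CkM => //; exact: Ck_partial.
Qed.

Lemma Ck_expR m U f : open U -> Ck m U f -> Ck m U (fun z => expR (f z)).
Proof.
move=> oU; elim: m f => [|m IH] f cf.
  move=> y Uy; split => //; apply: continuous_comp; first exact: Ck_cont cf Uy.
  exact: continuous_expR.
by apply: (@Ck_chain _ _ _ expR expR) => //; exact/IH/Ck_pred.
Qed.

Lemma Ck_inv m U f : open U -> (forall y, U y -> f y != 0) -> Ck m U f ->
  Ck m U (fun z => (f z)^-1).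
Proof.
move=> oU f0; elim: m => [|m IH] cf.
  move=> y Uy; split => //; apply: continuousV; first exact: f0.
  exact: Ck_cont cf Uy.
apply: (@Ck_chain _ _ _ GRing.inv (fun t => - (t^-1 * t^-1))) => //.
  move=> y Uy; have [d1 d2] : is_derive (f y) (1 : R) id 1 := is_derive_id _ _.
  split; first exact: (@derivableV R R id _ _ (f0 y Uy) d1).
  rewrite (@deriveV R R id _ _ (f0 y Uy) d1) d2 [LHS]mulr1.
  by rewrite -invfM -expr2.
by apply: CkN => //; apply: CkM => //; exact/IH/Ck_pred.
Qed.

Lemma Ck_sqrt m U f : open U -> (forall y, U y -> 0 < f y) -> Ck m U f ->
  Ck m U (fun z => Num.sqrt (f z)).
Proof.
move=> oU f0; elim: m => [|m IH] cf.
  move=> y Uy; split => //; apply: continuous_comp; first exact: Ck_cont cf Uy.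
  exact: sqrt_continuous.
apply: (@Ck_chain _ _ _ Num.sqrt (fun t => (2 * Num.sqrt t)^-1)) => //.
  by move=> y Uy; apply: is_derive1_sqrt; exact: f0.
apply: Ck_inv => // [y Uy|].
  by rewrite mulf_neq0// gt_eqF// sqrtr_gt0 f0.
by apply: CkM => //; [exact: Ck_cst|exact/IH/Ck_pred].
Qed.

Lemma Ck_det m U k (A : V -> 'M[R]_k) : open U ->
  (forall a b : 'I_k, Ck m U (fun z => A z a b)) -> Ck m U (fun z => \det (A z)).
Proof.
move=> oU H; apply: Ck_sum => // s _; apply: CkM => //; first exact: Ck_cst.
by apply: Ck_prod => // i _; exact: H.
Qed.

(** Cramer's rule writes the entries of the inverse as polynomials in the entries of A divided by
    the determinant. *)
Lemma Ck_invmx m U k (A : V -> 'M[R]_k) : open U ->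
  (forall y, U y -> A y \in unitmx) ->
  (forall a b : 'I_k, Ck m U (fun z => A z a b)) ->
  forall a b : 'I_k, Ck m U (fun z => invmx (A z) a b).
Proof.
move=> oU Au H i j.
apply: (@Ck_ext _ _ (fun z => (\det (A z))^-1 *
   ((-1) ^+ (j + i) * \det (row' j (col' i (A z)))))) => // [y Uy|].
  by rewrite /invmx Au// !mxE.
apply: CkM => //.
  by apply: Ck_inv => //; [move=> y /Au; rewrite unitmxE unitfE|exact: Ck_det].
apply: CkM => //; first exact: Ck_cst.
apply: Ck_det => // a b.
apply: (@Ck_ext _ _ (fun z => A z (lift j a) (lift i b))) => // y Uy.
by rewrite !mxE.
Qed.

End Ck.

(** * Integration of compactly supported functions *)

Lemma near_gt (R : realType) (T : topologicalType) (f : T -> R) (x : T) (z : R) :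
  {for x, continuous f} -> z < f x -> \forall y \near x, z < f y.
Proof. by move=> cf zf; apply: (@cvgr_gt R T (nbhs x) _ f (f x)). Qed.

Lemma near_norm_gt (R : realType) (V : normedModType R) (x : V) (B : R) :
  B < `|x| -> \forall y \near x, B < `|y|.
Proof. by move=> Bx; exact: (near_gt (@norm_continuous _ V x) Bx). Qed.

Section LineIntegral.
Variable R : realType.
Local Notation mu := (@lebesgue_measure R).
Local Notation RR := (measurableTypeR R).

(** Support is recorded by one explicit radius, since the same radius serves all slices of a
    function and enters the bounds on integrals. *)
Definition box_supported (V : normedModType R) (B : R) (f : V -> R) : Prop :=
  forall x, B < `|x| -> f x = 0.

Variable B : R.
Hypothesis B0 : 0 < B.
Implicit Types f : RR -> R.

Let D : set RR := `[- B, B]%classic.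

Let mD : measurable D. Proof. exact: measurable_itv. Qed.

Let muD : fine (mu D) = 2 * B.
Proof.
rewrite /D lebesgue_measure_itv /= lte_fin ifT; last by rewrite gtrN.
by rewrite -EFinB /= opprK mulr_natl.
Qed.

Lemma box_supported_restrict f : box_supported B (f : R -> R) -> f = f \_ D.
Proof.
move=> bf; apply/funext => t; rewrite patchE; case: ifPn => // tD.
apply: bf; rewrite ltNge ler_norml; apply: contra tD => tB.
by rewrite inE /D /= in_itv.
Qed.

Lemma line_integrable f : continuous (f : R -> R) -> box_supported B (f : R -> R) ->
  mu.-integrable setT (EFin \o f).
Proof.
move=> cf bf.
have H : mu.-integrable D (EFin \o f).
  apply: continuous_compact_integrable; first exact: segment_compact.
  exact: continuous_subspaceT.
move/(integrable_mkcond _ mD) : H; rewrite restrict_EFin.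
by rewrite -box_supported_restrict.
Qed.

Lemma Rintegral_box f : box_supported B (f : R -> R) ->
  (\int[mu]_t f t = \int[mu]_(t in D) f t)%R.
Proof. by move=> bf; rewrite [RHS]Rintegral_mkcond -box_supported_restrict. Qed.

Lemma line_integral_bound f M : continuous (f : R -> R) -> box_supported B (f : R -> R) ->
  (forall t, `|f t| <= M) -> `|(\int[mu]_t f t)%R| <= 2 * B * M.
Proof.
move=> cf bf fM; rewrite Rintegral_box//.
have intf : mu.-integrable D (EFin \o f).
  by apply: integrableS (line_integrable cf bf).
apply: (le_trans (le_normr_Rintegral mD intf)).
rewrite -muD mulrC -Rintegral_cst//.
apply: le_Rintegral => //.
  have : mu.-integrable D (abse \o (EFin \o f)) by exact: integrable_abse.
  by [].
apply: continuous_compact_integrable; first exact: segment_compact.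
by apply: continuous_subspaceT; exact: cst_continuous.
Qed.

Lemma line_integral_deriv (f : R -> R) : box_supported B f ->
  (forall t : R, derivable f t 1) -> continuous (derive1 f) ->
  (\int[mu]_t (derive1 f t) = 0)%R.
Proof.
move=> bf df cf.
have cff : continuous f.
  by move=> t; apply/differentiable_continuous/derivable1_diffP.
(* The endpoints lie strictly beyond B, because [box_supported] says nothing at distance exactly
   B. *)
pose a := - (B + 1); pose b := B + 1.
have B0' := B0; have ab : a < b by rewrite /a /b; lra.
have bdf : box_supported B (derive1 f).
  move=> t tB; rewrite derive1E.
  have -> : 'D_1 f t = 'D_1 (fun=> 0 : R) t.
    apply: near_eq_derive.
    by apply: filterS (near_norm_gt tB) => s; exact: bf.
  exact: derive_cst.
have e : (\int[mu]_t (derive1 f t) = \int[mu]_(t in (`[a, b]%classic : set RR)) (derive1 f t))%R.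
  rewrite [RHS]Rintegral_mkcond; congr Rintegral; apply/funext => t.
  rewrite patchE; case: ifPn => // tab; apply: bdf.
  rewrite ltNge ler_norml; apply: contra tab => /andP[t1 t2].
  by rewrite inE /= in_itv/= /a /b; apply/andP; split; lra.
have B1 : B < `|B + 1| by rewrite ger0_norm; lra.
have fa : f a = 0 by apply: bf; rewrite /a normrN.
have fb : f b = 0 by exact: bf.
have c1 : {within `[a, b], continuous (derive1 f)} by exact: continuous_subspaceT.
have c2 : derivable_oo_LRcontinuous f a b.
  split; first by move=> x _.
  - by apply: cvg_at_right_filter; exact: cff.
  - by apply: cvg_at_left_filter; exact: cff.
have := @continuous_FTC2 R (derive1 f) f a b ab c1 c2 (fun _ _ => erefl).
by rewrite fa fb subee // e /Rintegral => ->.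
Qed.

Lemma line_integral_gt0 f (t0 : R) : continuous (f : R -> R) -> box_supported B (f : R -> R) ->
  (forall t, 0 <= f t) -> 0 < f t0 -> 0 < (\int[mu]_t f t)%R.
Proof.
move=> cf bf f0 ft0.
have : \forall t \near (t0 : R), f t0 / 2 < f t.
  apply: (near_gt (cf t0)).
  by rewrite ltr_pdivrMr// ltr_pMr// ltr1n.
move=> /nbhs_ballP[d /= d0 Hd].
(* The closed interval of half the radius lies in the ball where f exceeds f(t0)/2, and its length
   is d. *)
pose J : set RR := `[t0 - d / 2, t0 + d / 2]%classic.
have mJ : measurable J by exact: measurable_itv.
have iJ : mu.-integrable J (EFin \o f).
  by apply: integrableS (line_integrable cf bf).
apply: (@lt_le_trans _ _ (\int[mu]_(t in J) f t)%R).
  apply: (@lt_le_trans _ _ (\int[mu]_(t in J) (f t0 / 2))%R).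
    have muJ : fine (mu J) = d.
      rewrite /J lebesgue_measure_itv /= lte_fin ifT; last by lra.
      by rewrite -EFinB /=; lra.
    by rewrite Rintegral_cst// muJ mulr_gt0// divr_gt0.
  apply: le_Rintegral => //.
    apply: continuous_compact_integrable; first exact: segment_compact.
    by apply: continuous_subspaceT; exact: cst_continuous.
  move=> t; rewrite /J /= in_itv /= => /andP[t1 t2]; apply/ltW/Hd.
  by rewrite /ball /= ltr_norml; apply/andP; split; lra.
rewrite Rintegral_mkcond; apply: le_Rintegral => //.
- by rewrite -restrict_EFin; apply/(integrable_mkcond _ mJ).
- exact: line_integrable.
- by move=> t _; rewrite patchE; case: ifP.
Qed.

End LineIntegral.

Section UniformContinuity.
Variables (R : realType) (n : nat).
Local Notation V := 'rV[R]_n.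

Lemma box_supported_unif (B : R) (F : V -> R) : 0 < B -> continuous F ->
  box_supported B F -> forall e, 0 < e ->
  exists2 d, 0 < d & forall x y : V, `|x - y| < d -> `|F x - F y| <= e.
Proof.
move=> B0 cF bF e e0.
(* The margin 1, together with [d' <= 1] below, ensures that the points close to a point outside K
   lie outside the support too. *)
pose K : set V := [set x | `|x| <= B + 1].
have cK : compact K.
  apply: bounded_closed_compact.
    exists (B + 1); split; first exact: num_real.
    by move=> x Bx y /= yB; exact: le_trans yB (ltW Bx).
  apply: (@preimage_closed _ _ (fun x : V => `|x|) [set t : R | t <= B + 1]).
    by move=> z zK; exact: norm_continuous.
  exact: closed_le.
(* Compactness is used as a near covering over the filter of small positive radii, which gives one
   radius valid on all of K. *)
have /compact_near_coveringP H := cK.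
have := H R (0^'+) (fun d x => forall y : V, `|x - y| < d -> `|F x - F y| <= e) _.
case=> [x _|d /= d0 Hd].
  have e20 : 0 < e / 2 by rewrite divr_gt0.
  have /cvgrPdist_le/(_ _ e20)/nbhs_ballP[r /= r0 Hr] := cF x.
  have r20 : 0 < r / 2 by rewrite divr_gt0.
  exists (ball x (r / 2), [set d | d < r / 2]).
    split; first exact: nbhsx_ballx.
    exact: nbhs_right_lt.
  move=> [x' d] /= [xx' dr] y x'y.
  rewrite -ball_normE /= in xx'.
  have h1 : `|F x - F x'| <= e / 2.
    apply: Hr; rewrite -ball_normE /=; apply: lt_trans xx' _; lra.
  have h2 : `|F x - F y| <= e / 2.
    apply: Hr; rewrite -ball_normE /=.
    have -> : x - y = (x - x') + (x' - y) by rewrite addrA subrK.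
    by apply: le_lt_trans (ler_normD _ _) _; lra.
  have -> : F x' - F y = (F x - F y) - (F x - F x') by ring.
  by apply: le_trans (ler_normB _ _) _; lra.
pose d' := Num.min (d / 2) 1.
have d'0 : 0 < d' by rewrite lt_min divr_gt0//=.
have Hd' : forall x y : V, `|x| <= B + 1 -> `|x - y| < d' -> `|F x - F y| <= e.
  move=> x y xB xy; apply: (Hd (d / 2)) => //=.
  - by rewrite sub0r normrN ger0_norm; lra.
  - by lra.
  - by apply: lt_le_trans xy _; rewrite ge_min lexx.
exists d' => // x y xy; have [xB|Bx] := leP `|x| (B + 1); first exact: Hd'.
have By : B < `|y|.
  have : `|x| <= `|x - y| + `|y| by rewrite -{1}(subrK y x) ler_normD.
  have : d' <= 1 by rewrite ge_min lexx orbT.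
  lra.
by rewrite !bF ?subrr ?normr0 ?ltW//; lra.
Qed.

End UniformContinuity.

(** * Iterated integrals over R^n *)

Section RnIntegral.
Variable R : realType.
Local Notation mu := (@lebesgue_measure R).

Definition slice n (t : R) (F : 'rV[R]_n.+1 -> R) : 'rV[R]_n -> R :=
  fun y => F (row_mx (t%:M : 'rV[R]_1) y).

(** A real-valued version of [integral_Rn]. On [Cc] the two agree ([integral_RnE]), and linearity
    can be used without side conditions on infinite values. *)
Fixpoint Rn_integral n : ('rV[R]_n -> R) -> R :=
  match n with
  | 0 => fun F => F 0
  | n'.+1 => fun F => (\int[mu]_t Rn_integral (slice t F))%R
  end.

Definition Cc n (B : R) (F : 'rV[R]_n -> R) : Prop :=
  continuous F /\ box_supported B F.

Lemma row_mx_head n (t : R) (y : 'rV[R]_n) :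
  (row_mx (t%:M : 'rV[R]_1) y : 'rV[R]_n.+1) ord0 ord0 = t.
Proof.
have -> : (ord0 : 'I_n.+1) = lshift n (ord0 : 'I_1) by exact: val_inj.
transitivity ((t%:M : 'rV[R]_1) ord0 ord0); last by rewrite mxE eqxx mulr1n.
exact: row_mxEl.
Qed.

Lemma row_mx_tail n (t : R) (y : 'rV[R]_n) j :
  (row_mx (t%:M : 'rV[R]_1) y : 'rV[R]_n.+1) ord0 (lift ord0 j) = y ord0 j.
Proof.
have -> : lift ord0 j = rshift 1 j by exact: val_inj.
exact: row_mxEr.
Qed.

Lemma row_cons_affine n (s t h : R) (x y : 'rV[R]_n) :
  row_mx ((h * s + t)%:M : 'rV[R]_1) (h *: x + y) =
  h *: row_mx (s%:M : 'rV[R]_1) x + row_mx (t%:M : 'rV[R]_1) y :> 'rV[R]_n.+1.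
Proof.
apply/rowP => i; rewrite [RHS]mxE [X in _ = X + _]mxE.
case: (unliftP ord0 i) => [j ->|->].
  by rewrite !row_mx_tail !mxE.
by rewrite !row_mx_head.
Qed.

Lemma row_cons_norm n (t : R) (y : 'rV[R]_n) (r : R) : 0 <= r ->
  `|t| <= r -> `|y| <= r -> `|row_mx (t%:M : 'rV[R]_1) y : 'rV[R]_n.+1| <= r.
Proof.
move=> r0 tr yr; apply: row_norm_le => // i.
case: (unliftP ord0 i) => [j ->|->]; last by rewrite row_mx_head.
by rewrite row_mx_tail (le_trans (coord_norm_le _ _)).
Qed.

Lemma row_cons_norm_tail n (t : R) (y : 'rV[R]_n) :
  `|y| <= `|row_mx (t%:M : 'rV[R]_1) y : 'rV[R]_n.+1|.
Proof.
by apply: row_norm_le => // i; rewrite -(row_mx_tail t); exact: coord_norm_le.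
Qed.

Lemma row_cons_norm_head n (t : R) (y : 'rV[R]_n) :
  `|t| <= `|row_mx (t%:M : 'rV[R]_1) y : 'rV[R]_n.+1|.
Proof. by rewrite -{1}(row_mx_head t y); exact: coord_norm_le. Qed.

Lemma row_consB n (s t : R) (x y : 'rV[R]_n) :
  (row_mx (s%:M : 'rV[R]_1) x : 'rV[R]_n.+1) - row_mx (t%:M : 'rV[R]_1) y =
  row_mx ((s - t)%:M : 'rV[R]_1) (x - y).
Proof.
have := row_cons_affine t s (-1) y x.
by rewrite !scaleN1r mulN1r addrC [- y + x]addrC => ->; rewrite addrC.
Qed.

Lemma slice_continuous n (t : R) (F : 'rV[R]_n.+1 -> R) :
  continuous F -> continuous (slice t F).
Proof.
move=> cF y; apply/(@cvgrPdist_le _ _ _ (nbhs y) (nbhs_filter y)) => e e0.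
have /cvgrPdist_le/(_ _ e0)/nbhs_ballP[r /= r0 Hr] := cF (row_mx (t%:M : 'rV[R]_1) y).
apply/nbhs_ballP; exists r => // z; rewrite -ball_normE /= => yz.
apply: Hr; rewrite -ball_normE /= row_consB subrr.
by apply: le_lt_trans yz; apply: row_cons_norm; rewrite ?normr0.
Qed.

Lemma Cc_slice n B (t : R) (F : 'rV[R]_n.+1 -> R) : Cc B F -> Cc B (slice t F).
Proof.
move=> [cF bF]; split; first exact: slice_continuous.
by move=> y By; apply: bF; apply: lt_le_trans By (row_cons_norm_tail _ _).
Qed.

Lemma slice_out n B (t : R) (F : 'rV[R]_n.+1 -> R) : box_supported B F ->
  B < `|t| -> slice t F = fun=> 0.
Proof.
move=> bF Bt; apply/funext => y; apply: bF.
exact: lt_le_trans Bt (row_cons_norm_head _ _).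
Qed.

Lemma Cc_lin n B (a b : R) (F G : 'rV[R]_n -> R) : Cc B F -> Cc B G ->
  Cc B (fun y => a * F y + b * G y).
Proof.
move=> [cF bF] [cG bG]; split; last by move=> y By; rewrite bF// bG// !mulr0 addr0.
move=> y; apply: (@continuousD _ _ _ (fun y => a * F y) (fun y => b * G y)).
  by apply: (@continuousM _ _ (fun=> a) F); [exact: cst_continuous|exact: cF].
by apply: (@continuousM _ _ (fun=> b) G); [exact: cst_continuous|exact: cG].
Qed.

Lemma Rn_integral0 n : Rn_integral (fun _ : 'rV[R]_n => 0) = 0.
Proof.
elim: n => //= n IH.
have -> : (fun t : R => Rn_integral (slice t (fun _ : 'rV[R]_n.+1 => 0))) = fun=> 0.
  by apply/funext => t; rewrite -[RHS]IH.
by rewrite Rintegral_cst// mul0r.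
Qed.

Section Bounded.
Variable B : R.
Hypothesis B0 : 0 < B.

(** Linearity and the bound go through one induction on the dimension. Together they show in [cI]
    that the inner integral depends continuously on the outer variable, which makes the outer
    integrals converge in the next dimension. *)
Let lin_prop n := forall a b (F G : 'rV[R]_n -> R), Cc B F -> Cc B G ->
  Rn_integral (fun y => a * F y + b * G y) = a * Rn_integral F + b * Rn_integral G.

Let bnd_prop n := forall (F : 'rV[R]_n -> R) M, Cc B F -> (forall y, `|F y| <= M) ->
  `|Rn_integral F| <= (2 * B) ^+ n * M.

Let cI n (F : 'rV[R]_n.+1 -> R) : lin_prop n -> bnd_prop n ->
  Cc B F -> continuous (fun t : R => Rn_integral (slice t F)).
Proof.
move=> lin bnd CF t; apply/cvgrPdist_le => e e0.
have B0' := B0.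
pose c := (2 * B) ^+ n + 1.
have c0 : 0 < c by rewrite ltr_wpDl// exprn_ge0//; lra.
have [cF bF] := CF.
have [d d0 Hd] := box_supported_unif B0 cF bF (divr_gt0 e0 c0).
apply/nbhs_ballP; exists d => // s; rewrite /ball /= => ts.
(* Linearity turns the difference of two slice integrals into one integral of a uniformly small
   function. *)
have := lin 1 (-1) _ _ (Cc_slice t CF) (Cc_slice s CF).
rewrite mul1r mulN1r => <-.
apply: (@le_trans _ _ ((2 * B) ^+ n * (e / c))).
  apply: bnd; first by apply: Cc_lin; exact: Cc_slice.
  move=> y; rewrite mul1r mulN1r; apply: Hd; rewrite row_consB subrr.
  by apply: le_lt_trans ts; apply: row_cons_norm; rewrite ?normr0.
rewrite mulrCA ler_piMr ?(ltW e0)// ler_pdivrMr// mul1r /c; lra.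
Qed.

Lemma Rn_integral_slice_box n (F : 'rV[R]_n.+1 -> R) : box_supported B F ->
  box_supported B (fun t : R => Rn_integral (slice t F)).
Proof. by move=> bF t Bt; rewrite (slice_out bF Bt) Rn_integral0. Qed.

Let Rn_integral_props n : lin_prop n /\ bnd_prop n.
Proof.
elim: n => [|n [lin bnd]].
  by split=> // F M _ H /=; rewrite expr0 mul1r.
have cG (F : 'rV[R]_n.+1 -> R) (CF : Cc B F) := cI lin bnd CF.
have bI (F : 'rV[R]_n.+1 -> R) (CF : Cc B F) := Rn_integral_slice_box CF.2.
split.
  move=> a b F G CF CG /=.
  have -> : (fun t => Rn_integral (slice t (fun y => a * F y + b * G y))) =
     fun t => a * Rn_integral (slice t F) + b * Rn_integral (slice t G).
    by apply/funext => t; exact: (lin a b _ _ (Cc_slice t CF) (Cc_slice t CG)).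
  have iF := line_integrable (cG F CF) (bI F CF).
  have iG := line_integrable (cG G CG) (bI G CG).
  have iaF : mu.-integrable setT (EFin \o (fun t => a * Rn_integral (slice t F))).
    have := integrableZl measurableT a iF; congr (integrable _ _ _).
  have ibG : mu.-integrable setT (EFin \o (fun t => b * Rn_integral (slice t G))).
    have := integrableZl measurableT b iG; congr (integrable _ _ _).
  by rewrite RintegralD// RintegralZl// RintegralZl.
move=> F M CF FM /=.
rewrite exprS -mulrA; apply: (line_integral_bound B0 (cG F CF) (bI F CF)).
move=> t; apply: bnd; first exact: Cc_slice.
by move=> y; exact: FM.
Qed.

Lemma Rn_integral_lin n a b (F G : 'rV[R]_n -> R) : Cc B F -> Cc B G ->
  Rn_integral (fun y => a * F y + b * G y) = a * Rn_integral F + b * Rn_integral G.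
Proof. by case: (Rn_integral_props n) => H _; exact: H. Qed.

Lemma Rn_integral_bound n (F : 'rV[R]_n -> R) M : Cc B F -> (forall y, `|F y| <= M) ->
    `|Rn_integral F| <= (2 * B) ^+ n * M.
Proof. by case: (Rn_integral_props n) => _; apply. Qed.

Lemma Rn_integral_slice_continuous n (F : 'rV[R]_n.+1 -> R) : Cc B F ->
  continuous (fun t : R => Rn_integral (slice t F)).
Proof. by case: (Rn_integral_props n) => lin bnd; exact: cI. Qed.

Lemma integral_RnE n (F : 'rV[R]_n -> R) : Cc B F ->
  integral_Rn (fun y => (F y)%:E) = (Rn_integral F)%:E.
Proof.
elim: n F => [//|n IH] F CF /=.
have -> : (fun t : R => integral_Rn (fun y : 'rV[R]_n => (F (row_mx (t%:M : 'rV[R]_1) y))%:E)) =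
  fun t => (Rn_integral (slice t F))%:E.
  by apply/funext => t; apply: (IH (slice t F)); exact: Cc_slice.
rewrite /Rintegral fineK//; apply: integrable_fin_num => //.
apply: (line_integrable); first exact: Rn_integral_slice_continuous.
exact: Rn_integral_slice_box CF.2.
Qed.

Lemma Rn_integral_ge0 n (F : 'rV[R]_n -> R) : (forall y, 0 <= F y) -> 0 <= Rn_integral F.
Proof.
elim: n F => [F F0|n IH F F0]; first exact: F0.
rewrite /=; apply: Rintegral_ge0 => t _.
by apply: IH => y; exact: F0.
Qed.

Lemma Rn_integral_gt0 n (F : 'rV[R]_n -> R) y0 : Cc B F -> (forall y, 0 <= F y) ->
  0 < F y0 -> 0 < Rn_integral F.
Proof.
elim: n F y0 => [|n IH] F y0 CF F0 Fy0 /=.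
  by have -> : 0 = y0 by apply/rowP => -[].
apply: (@line_integral_gt0 _ B _ (y0 ord0 ord0)).
- exact: Rn_integral_slice_continuous.
- exact: Rn_integral_slice_box CF.2.
- by move=> t; apply: Rn_integral_ge0 => y; exact: F0.
apply: (IH _ (\row_j y0 ord0 (lift ord0 j))).
- exact: Cc_slice.
- by move=> y; exact: F0.
suff -> : slice (y0 ord0 ord0) F (\row_j y0 ord0 (lift ord0 j)) = F y0 by [].
rewrite /slice; congr F; apply/rowP => i.
by case: (unliftP ord0 i) => [j ->|->]; rewrite ?row_mx_tail ?row_mx_head ?mxE.
Qed.

End Bounded.

Lemma basis_vec_head n : row_mx ((1 : R)%:M : 'rV[R]_1) 0 = basis_vec R (ord0 : 'I_n.+1).
Proof.
apply/rowP => i; rewrite [RHS]mxE eqxx /=.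
case: (unliftP ord0 i) => [j ->|->]; last by rewrite row_mx_head.
by rewrite row_mx_tail mxE.
Qed.

Lemma basis_vec_tail n (j : 'I_n) :
  row_mx ((0 : R)%:M : 'rV[R]_1) (basis_vec R j) = basis_vec R (lift ord0 j).
Proof.
apply/rowP => i; rewrite [RHS]mxE eqxx /=.
case: (unliftP ord0 i) => [k ->|->]; last by rewrite row_mx_head.
by rewrite row_mx_tail mxE eqxx /= (inj_eq lift_inj).
Qed.

Lemma slice_growth n (t : R) (F : 'rV[R]_n.+1 -> R) (j : 'I_n) y :
  (fun h : R => h^-1 *: ((slice t F \o shift y) (h *: basis_vec R j) - slice t F y)) =
  (fun h : R => h^-1 *: ((F \o shift (row_mx (t%:M : 'rV[R]_1) y))
       (h *: basis_vec R (lift ord0 j)) -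
     F (row_mx (t%:M : 'rV[R]_1) y))).
Proof.
apply/funext => h; rewrite /slice /= -basis_vec_tail; congr (_ *: (F _ - _)).
by rewrite -row_cons_affine mulr0 add0r.
Qed.

Lemma partial_slice n (t : R) (F : 'rV[R]_n.+1 -> R) (j : 'I_n) :
  partial j (slice t F) = slice t (partial (lift ord0 j) F).
Proof. by apply/funext => y; rewrite /partial /derive slice_growth. Qed.

Lemma Ck1_slice n (t : R) (F : 'rV[R]_n.+1 -> R) : Ck 1 setT F -> Ck 1 setT (slice t F).
Proof.
move=> F1; have cF : continuous F by move=> y; exact: (Ck_cont F1).
apply: CkS => [y _|j y _|j].
- exact: slice_continuous.
- rewrite /derivable slice_growth; exact: (@Ck_derivable _ _ _ _ _ _ (lift ord0 j) F1).
- rewrite partial_slice => y _; split => //; apply: slice_continuous.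
  by move=> z; exact: (@Ck_cont _ _ 0 setT _ z (@Ck_partial _ _ _ _ _ (lift ord0 j) F1) I).
Qed.

Lemma box_supported_partial n B (F : 'rV[R]_n -> R) i : box_supported B F ->
  box_supported B (partial i F).
Proof.
move=> bF y By; rewrite -(partial_cst i 0 y); apply: near_eq_derive.
by apply: filterS (near_norm_gt By) => z; exact: bF.
Qed.

Lemma Cc_partial n B (F : 'rV[R]_n -> R) i : Ck 1 setT F -> box_supported B F ->
  Cc B (partial i F).
Proof.
move=> F1 bF; split; last exact: box_supported_partial.
by move=> y; exact: (@Ck_cont _ _ 0 setT _ y (@Ck_partial _ _ _ _ _ i F1) I).
Qed.

Lemma Rn_integral_partial n B (F : 'rV[R]_n -> R) i : 0 < B -> Ck 1 setT F ->
  box_supported B F -> Rn_integral (partial i F) = 0.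
Proof.
move=> B0; elim: n F i => [F []//|n IH] F i F1 bF /=.
have cF : continuous F by move=> y; exact: (Ck_cont F1).
have CF : Cc B F by [].
case: (unliftP ord0 i) => [j ->|->].
  have -> : (fun t => Rn_integral (slice t (partial (lift ord0 j) F))) = fun=> 0.
    apply/funext => t; rewrite -partial_slice; apply: IH; first exact: Ck1_slice.
    exact: (Cc_slice t CF).2.
  by rewrite Rintegral_cst// mul0r.
(* differentiate under the outer integral, then integrate the derivative *)
set dF := partial ord0 F.
have CdF : Cc B dF by exact: Cc_partial.
pose G (t : R) := Rn_integral (slice t F).
have dG (t : R) : is_derive t (1 : R) G (Rn_integral (slice t dF)).
  suff H : (fun h : R => h^-1 *: ((G \o shift t) (h *: 1) - G t)) @ 0^' -->
      Rn_integral (slice t dF).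
    by split; [apply/cvg_ex; exists (Rn_integral (slice t dF))|exact/cvg_lim].
  apply/cvgrPdist_le => e e0.
  pose c := (2 * B) ^+ n + 1.
  have c0 : 0 < c by rewrite ltr_wpDl// exprn_ge0//; lra.
  have [cdF bdF] := CdF.
  have [d d0 Hd] := box_supported_unif B0 cdF bdF (divr_gt0 e0 c0).
  apply/nbhs_ballP; exists d => // h; rewrite /ball /= sub0r normrN => hd h0.
  have -> : [the R of h *: (1 : R)] + t = h + t by rewrite [_ *: _]mulr1.
  have -> : Rn_integral (slice t dF) - h^-1 *: (G (h + t) - G t) =
     - (h^-1 * (G (h + t) - G t - h * Rn_integral (slice t dF))).
    suff key (a b c' : R) : a - h^-1 * (b - c') = - (h^-1 * (b - c' - h * a)) by exact: key.
    by field.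
  rewrite normrN normrM normfV ler_pdivrMl ?normr_gt0//.
  (* The remainder of the difference quotient is the integral of the pointwise remainder, which the
     mean value estimate and the uniform continuity of [dF] bound by [e / c * |h|]. *)
  have C1 := Cc_lin 1 (-1) (Cc_slice (h + t) CF) (Cc_slice t CF).
  have <- : Rn_integral (fun y => 1 * (1 * slice (h + t) F y + -1 * slice t F y) +
       - h * slice t dF y) = G (h + t) - G t - h * Rn_integral (slice t dF).
    rewrite (Rn_integral_lin B0 _ _ C1 (Cc_slice t CdF)).
    rewrite (Rn_integral_lin B0 _ _ (Cc_slice (h + t) CF) (Cc_slice t CF)).
    by rewrite !mul1r mulN1r mulNr.
  apply: (@le_trans _ _ ((2 * B) ^+ n * (e / c * `|h|))).
    apply: (Rn_integral_bound B0); first exact: (Cc_lin _ _ C1 (Cc_slice t CdF)).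
    move=> y; rewrite !mul1r mulN1r mulNr.
    pose p := row_mx (t%:M : 'rV[R]_1) y : 'rV[R]_n.+1.
    have E s : s *: basis_vec R ord0 + p = row_mx ((s + t)%:M : 'rV[R]_1) y.
      by rewrite -basis_vec_head /p -row_cons_affine mulr1 scaler0 add0r.
    have := @ler_dist_affine R (fun s => F (s *: basis_vec R ord0 + p))
      (fun s => dF (s *: basis_vec R ord0 + p)) h (dF p) (e / c) _ _.
    rewrite E E add0r; apply.
      by move=> s _; apply: is_derive_slice; exact: (@Ck_derivable _ _ 0 setT _ _ ord0 F1 I).
    move=> s sh; apply: Hd; rewrite addrK.
    apply: le_lt_trans hd; apply: le_trans sh.
    rewrite -basis_vec_head normrZ ler_piMr//.
    by apply: row_cons_norm; rewrite ?normr1 ?normr0.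
  rewrite mulrA [leLHS]mulrC ler_wpM2l// mulrCA ler_piMr ?(ltW e0)//.
  by rewrite ler_pdivrMr// mul1r /c; lra.
have -> : (fun t => Rn_integral (slice t dF)) = derive1 G.
  by apply/funext => t; rewrite derive1E; have [_ ->] := dG t.
apply: (@line_integral_deriv _ B).
- exact: B0.
- exact: (Rn_integral_slice_box bF).
- by move=> t; have [] := dG t.
- have -> : derive1 G = fun t => Rn_integral (slice t dF).
    by apply/funext => t; rewrite derive1E; have [_ ->] := dG t.
  exact: (Rn_integral_slice_continuous B0 CdF).
Qed.

End RnIntegral.

(** * C^1 functions: composition, extension, bumps *)

Lemma Ck1_differentiable (R : realType) (n : nat) (U : set 'rV[R]_n)
    (f : 'rV[R]_n -> R) y : open U -> Ck 1 U f -> U y ->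
  differentiable f y.
Proof.
move=> oU f1 Uy.
have cp i z : U z -> {for z, continuous (partial i f)}.
  by move=> Uz; exact: (@Ck_cont _ _ 0 U _ z (@Ck_partial _ _ _ _ _ i f1) Uz).
apply: (partials_differentiable oU Uy) => [i z Uz|i]; last exact: cp.
exact: (@Ck_derivable _ _ 0 U _ z i f1 Uz).
Qed.


Section Composition.
Variables (R : realType) (n m : nat).
Local Notation V := 'rV[R]_n.
Local Notation W := 'rV[R]_m.

Lemma row_differentiable (tau : V -> W) y :
  (forall j, differentiable (fun z => tau z ord0 j) y) -> differentiable tau y.
Proof.
move=> dt.
have -> : tau = \sum_(j < m) (fun z => tau z ord0 j *: basis_vec R j).
  by apply/funext => z; rewrite fct_sumE {1}(row_sum_delta (tau z)).
by apply: differentiable_sum => j; exact: differentiableZl.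
Qed.

Lemma derive_row (tau : V -> W) y v j : differentiable tau y ->
  ('D_v tau y) ord0 j = 'D_v (fun z => tau z ord0 j) y.
Proof. by move=> dt; rewrite derive_mx ?mxE//; exact: diff_derivable. Qed.

Lemma derive_comp_row (tau : V -> W) (f : W -> R) y v : differentiable tau y ->
  differentiable f (tau y) ->
  'D_v (f \o tau) y = \sum_j 'D_v (fun z => tau z ord0 j) y * partial j f (tau y).
Proof.
move=> dt df; rewrite deriveE; last exact: differentiable_comp.
rewrite diff_comp//= -!deriveE// diff_partial//.
by apply: eq_bigr => j _; rewrite derive_row.
Qed.

(** Order one is what moving a test function from one chart to another requires. The chain rule
    expresses the partial derivatives of the composite by those of f and [tau]. *)
Lemma Ck1_comp (U : set V) (U' : set W) (tau : V -> W) (f : W -> R) :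
  open U -> open U' -> (forall j, Ck 1 U (fun z => tau z ord0 j)) ->
  Ck 1 U' f -> (forall y, U y -> U' (tau y)) -> Ck 1 U (f \o tau).
Proof.
move=> oU oU' t1 f1 UU'.
have dt y : U y -> differentiable tau y.
  by move=> Uy; apply: row_differentiable => j; exact: (Ck1_differentiable oU (t1 j) Uy).
have df y : U y -> differentiable f (tau y).
  by move=> /UU' Uy; exact: (Ck1_differentiable oU' f1 Uy).
apply: CkS => [y Uy|i y Uy|i].
- by apply: differentiable_continuous; apply: differentiable_comp; [exact: dt|exact: df].
- by apply: diff_derivable; apply: differentiable_comp; [exact: dt|exact: df].
apply: (@Ck_ext _ _ _ _ (fun z => \sum_j partial i (fun z => tau z ord0 j) z *
    partial j f (tau z))) => // [y Uy|].
  by rewrite /partial derive_comp_row//; [exact: dt|exact: df].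
apply: Ck_sum => // j _; apply: CkM => //; first exact: Ck_partial (t1 j).
move=> y Uy; split => //; apply: (@continuous_comp _ _ _ tau (partial j f)).
  by apply: differentiable_continuous; exact: dt.
exact: (@Ck_cont _ _ 0 U' _ _ (@Ck_partial _ _ _ _ _ j f1) (UU' _ Uy)).
Qed.

End Composition.

Section CompactExtension.
Variables (R : realType) (n : nat).
Local Notation V := 'rV[R]_n.

(** The open sets U and the complement of K cover the space: on the first the extension is f, on the
    second it vanishes. *)
Lemma Ck_extend m (U K : set V) (f : V -> R) : open U -> closed K -> K `<=` U ->
  (forall y, U y -> ~ K y -> f y = 0) -> Ck m U f -> Ck m setT (f \_ U).
Proof.
move=> oU cK KU f0 cf y _; have [Uy|Uy] := pselect (U y).
  apply: Ck_at_near (cf y Uy); apply: (near_open oU Uy) => z Uz.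
  by rewrite patchE mem_set.
apply: Ck_at_near (@Ck_cst R n m setT 0 y I).
apply: (@near_open _ _ (~` K)); [exact: closed_openC|by move/KU|].
move=> z Kz; rewrite patchE; case: ifPn => // /set_mem Uz.
by rewrite f0.
Qed.

Lemma compact_box (K : set V) : compact K -> exists2 B : R, 0 < B & forall y, K y -> `|y| <= B.
Proof.
move=> /compact_bounded [B [_ HB]]; exists (`|B| + 1); first by rewrite ltr_wpDl.
move=> y Ky; apply: HB => //; rewrite (le_lt_trans (ler_norm _))//.
by rewrite ltrDl.
Qed.

End CompactExtension.

Section Bump.
Variable R : realType.

(* Test functions only need to be C^1, because Green's formula differentiates
   them once. *)
Definition pos_sq (t : R) : R := (Num.max 0 t) ^+ 2.

Lemma pos_sq_ge0 t : 0 <= pos_sq t. Proof. exact: sqr_ge0. Qed.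

Lemma pos_sq0 t : t <= 0 -> pos_sq t = 0.
Proof. by move=> t0; rewrite /pos_sq max_l// expr0n. Qed.

Lemma pos_sqE t : 0 <= t -> pos_sq t = t ^+ 2.
Proof. by move=> t0; rewrite /pos_sq max_r. Qed.

Lemma max0_continuous : continuous (fun t : R => Num.max 0 t).
Proof.
move=> t; apply: (@continuous_max _ _ (fun=> 0) id); first exact: cst_continuous.
by move=> A HA.
Qed.

Lemma is_derive_pos_sq (t : R) : is_derive t (1 : R) pos_sq (2 * Num.max 0 t).
Proof.
have [t0|t0|->] := ltgtP t 0.
- have : \near t, (fun=> 0 : R) t = pos_sq t.
    have : \forall s \near t, s < 0 by exact: lt_nbhsl.
    by apply: filterS => s s0; rewrite pos_sq0// ltW.
  move=> H; rewrite mulr0.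
  by apply: (near_eq_is_derive H); exact: is_derive_cst.
- have : \near t, (fun s : R => s ^+ 2) t = pos_sq t.
    have : \forall s \near t, 0 < s by exact: lt_nbhsr.
    by apply: filterS => s s0; rewrite pos_sqE// ltW.
  move=> H.
  apply: (near_eq_is_derive H); split; first exact: exprn_derivable.
  rewrite exp_derive /= expr1; exact: mulr1.
(* At 0 the two formulas meet, and the difference quotient is at most [|h|] in absolute value. *)
- rewrite mulr0.
  suff H : (fun h : R => h^-1 *: ((pos_sq \o shift 0) (h *: 1) - pos_sq 0)) @ 0^' --> (0 : R).
    by split; [apply/cvg_ex; exists 0|exact/cvg_lim].
  apply/cvgrPdist_le => e e0.
  apply/nbhs_ballP; exists e => // h; rewrite /ball /= sub0r normrN => he h0.
  rewrite [h *: 1]mulr1 addr0 (pos_sq0 (lexx 0)) subr0 sub0r normrN.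
  rewrite [_ *: _]/(_ * _) normrM normfV ler_pdivrMl ?normr_gt0//.
  rewrite /pos_sq normrX expr2 ler_pM// (@le_trans _ _ `|h|)//; last exact: ltW.
    by case: (leP 0 h) => _ //; rewrite normr0.
  by case: (leP 0 h) => _ //; rewrite normr0.
Qed.

Lemma Ck1_pos_sq n (U : set 'rV[R]_n) (f : 'rV[R]_n -> R) : open U -> Ck 1 U f ->
  Ck 1 U (fun z => pos_sq (f z)).
Proof.
move=> oU f1; apply: (@Ck_chain _ _ _ _ _ pos_sq (fun t => 2 * Num.max 0 t)) => //.
  by move=> y _; exact: is_derive_pos_sq.
apply: CkM => //; first exact: Ck_cst.
move=> y Uy; split => //; apply: (@continuous_comp _ _ _ f (fun t : R => Num.max 0 t)).
  exact: Ck_cont f1 Uy.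
exact: max0_continuous.
Qed.

Variables (n : nat) (a : 'rV[R]_n) (r : R).
Hypothesis r0 : 0 < r.

(** The squared distance is Euclidean, hence polynomial in the coordinates, while [|y - a|] is the
    maximum norm, which is at most the Euclidean one: the support lies in the ball of radius r for
    either. The factor makes the value at the centre 2. *)
Definition ball_bump (y : 'rV[R]_n) : R :=
  2 / r ^+ 4 * pos_sq (r ^+ 2 - \sum_i (y ord0 i - a ord0 i) ^+ 2).

Lemma ball_bump_ge0 y : 0 <= ball_bump y.
Proof. by rewrite mulr_ge0 ?pos_sq_ge0// divr_ge0// exprn_ge0// ltW. Qed.

Lemma ball_bump_center : 1 < ball_bump a.
Proof.
rewrite /ball_bump big1 ?subr0; last by move=> i _; rewrite subrr expr0n.
rewrite pos_sqE ?exprn_ge0 ?ltW// -exprM divfK ?ltr1n//.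
by rewrite expf_neq0// gt_eqF.
Qed.

Lemma ball_bump_out y : ball_bump y != 0 -> `|y - a| <= r.
Proof.
have [//|ya] := leP `|y - a| r.
rewrite /ball_bump pos_sq0 ?mulr0 ?eqxx// subr_le0.
have ne : `|y - a| != 0 by rewrite gt_eqF// (lt_trans r0).
(* A coordinate that attains the maximum norm already contributes more than r^2 to the sum. *)
have [[i j] /= E] := mx_norm_neq0 ne.
rewrite (ord1 i) in E.
rewrite (bigD1 j)//= ler_wpDr ?sumr_ge0// => [k _|]; first exact: sqr_ge0.
have -> : (y ord0 j - a ord0 j) ^+ 2 = `|y - a| ^+ 2.
  have -> : `|y - a| = `|(y - a) ord0 j| by exact: E.
  by rewrite real_normK ?num_real// !mxE.
by rewrite ler_sqr ?nnegrE ?(ltW r0)// ltW.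
Qed.

Lemma Ck1_ball_bump : Ck 1 setT ball_bump.
Proof.
apply: CkM; [exact: openT|exact: Ck_cst|].
apply: Ck1_pos_sq; first exact: openT.
apply: CkB; [exact: openT|exact: Ck_cst|].
have cX i : Ck 1 setT (fun y : 'rV[R]_n => y ord0 i - a ord0 i).
  apply: CkB; [exact: openT| |exact: Ck_cst].
  apply: CkS => [y _|j y _|j].
  - by apply: differentiable_continuous; exact: differentiable_coord.
  - by apply: diff_derivable; exact: differentiable_coord.
  have -> : partial j (fun y : 'rV[R]_n => y ord0 i) = fun=> (basis_vec R j) ord0 i.
    apply/funext => y; rewrite /partial.
    have := @derive_mx R 'rV[R]_n 1 n id y (basis_vec R j) (@derivable_id _ _ _ _).
    by rewrite derive_id => ->; rewrite mxE.
  exact: Ck_cst.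
apply: Ck_sum; first exact: openT.
by move=> i _; apply: CkM => //; exact: openT.
Qed.

End Bump.

(** * Charts and the Riemannian measure *)

Section PositiveDefinite.
Variables (R : realType) (k : nat).

Definition posdef (A : 'M[R]_k) : Prop :=
  forall v : 'rV[R]_k, v != 0 -> 0 < (v *m A *m v^T) ord0 ord0.

Lemma posdef_unit (A : 'M[R]_k) : posdef A -> A \in unitmx.
Proof.
move=> pA; rewrite -row_free_unit -kermx_eq0; apply/rowV0P => v /sub_kermxP vA.
apply/eqP; apply: contraT => /pA; rewrite vA mul0mx mxE ltxx //.
Qed.

Lemma row_sqnorm_gt0 (v : 'rV[R]_k) : v != 0 -> 0 < (v *m v^T) ord0 ord0.
Proof.
move=> v0; rewrite mxE lt_neqAle sumr_ge0 ?andbT => [|i _]; last first.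
  by rewrite mxE -expr2 sqr_ge0.
apply: contra v0; rewrite eq_sym psumr_eq0 => [/allP H|i _]; last first.
  by rewrite mxE -expr2 sqr_ge0.
apply/eqP/rowP => i; have := H i (mem_index_enum i).
by rewrite !mxE -expr2 sqrf_eq0 => /eqP.
Qed.

Lemma posdef_segment (A : 'M[R]_k) (t : R) : posdef A -> 0 <= t <= 1 ->
  posdef ((1 - t)%:M + t *: A).
Proof.
move=> pA /andP[t0 t1] v v0.
rewrite mulmxDr mulmxDl mxE mul_mx_scalar -scalemxAl -scalemxAr -scalemxAl.
rewrite [X in X + _]mxE [X in _ + X]mxE.
have := pA v v0; have := row_sqnorm_gt0 v0.
set a := (_ *m _) _ _; set b := (_ *m _) _ _ => a0 b0.
have [->|tn1] := eqVneq t 1; first by rewrite subrr mul0r add0r mul1r.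
apply: ltr_wpDr; first by rewrite mulr_ge0// ltW.
by rewrite mulr_gt0// subr_gt0 lt_neqAle tn1.
Qed.

(* The determinant does not vanish along the segment from the identity. *)
Lemma posdef_det_gt0 (A : 'M[R]_k) : posdef A -> 0 < \det A.
Proof.
move=> pA; rewrite ltNge; apply/negP => dA.
(* A matrix of polynomials makes the determinant along the segment a polynomial, to which the
   intermediate value theorem applies; its value at 0 is 1. *)
pose M : 'M[{poly R}]_k := (1 - 'X)%:M + 'X *: map_mx polyC A.
have E t : (\det M).[t] = \det ((1 - t)%:M + t *: A).
  rewrite -[LHS]/(horner_eval t (\det M)) -det_map_mx; congr (\det _).
  apply/matrixP => i j; rewrite !mxE /horner_eval.
  transitivity (((1 - 'X) *+ (i == j) + 'X * (A i j)%:P).[t]); first by [].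
  by rewrite !hornerE hornerMn !hornerE.
have [] := @poly_ivt R (- \det M) 0 1 _ _.
- exact: ler01.
- rewrite !hornerN !E subr0 scale0r addr0 det1 subrr scale1r raddf0 add0r.
  by rewrite oppr_ge0 dA oppr_le0 ler01.
move=> t t01; rewrite rootE hornerN E oppr_eq0.
by have := posdef_unit (posdef_segment pA t01); rewrite unitmxE unitfE => /negPf ->.
Qed.

End PositiveDefinite.

Section Charts.
Variables (R : realType) (n : nat) (M : smooth_manifold R n).
Local Notation V := 'rV[R]_n.
Implicit Types (c d : chart R n M) (x : M) (y : V).

Lemma chart_img_mem c x : chart_dom c x -> chart_img c (c x).
Proof. by move=> cx; exists x. Qed.

Lemma chart_inv_dom c y : chart_img c y -> chart_dom c (chart_inv c y).
Proof. by move=> [x cx <-]; rewrite chart_mapK. Qed.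

Lemma chart_invK c y : chart_img c y -> c (chart_inv c y) = y.
Proof. by move=> [x cx <-]; rewrite chart_mapK. Qed.

Lemma chart_map_cont c x : chart_dom c x -> {for x, continuous c}.
Proof.
move=> cx; have := @chart_map_continuous _ _ _ c.
by rewrite continuous_open_subspace; [apply; rewrite inE|exact: chart_dom_open].
Qed.

Lemma chart_inv_cont c y : chart_img c y -> {for y, continuous (chart_inv c)}.
Proof.
move=> cy; have := @chart_inv_continuous _ _ _ c.
by rewrite continuous_open_subspace; [apply; rewrite inE|exact: chart_img_open].
Qed.

Lemma chart_inv_near c y (P : set M) : chart_img c y ->
  (\forall x \near chart_inv c y, P x) -> \forall z \near y, P (chart_inv c z).
Proof. by move=> cy; apply: (chart_inv_cont cy). Qed.

Lemma chart_dom_near c x : chart_dom c x -> \forall x' \near x, chart_dom c x'.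
Proof. by move=> cx; apply: open_nbhs_nbhs; split => //; exact: chart_dom_open. Qed.

Lemma chart_img_near c y : chart_img c y -> \forall z \near y, chart_img c z.
Proof. by move=> cy; apply: open_nbhs_nbhs; split => //; exact: chart_img_open. Qed.

Lemma chart_continuous c (f : M -> R) x : chart_dom c x ->
  {for c x, continuous (f \o chart_inv c)} -> {for x, continuous f}.
Proof.
move=> cx cf.
apply: (@near_continuous _ _ ((f \o chart_inv c) \o c)).
  by apply: filterS (chart_dom_near cx) => x' cx' /=; rewrite chart_mapK.
by apply: continuous_comp => //; exact: chart_map_cont.
Qed.

Lemma continuous_chart c (f : M -> R) y : chart_img c y ->
  {for chart_inv c y, continuous f} -> {for y, continuous (f \o chart_inv c)}.
Proof. by move=> cy cf; apply: continuous_comp => //; exact: chart_inv_cont. Qed.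

Definition Ck_fun (m : nat) (u : M -> R) : Prop :=
  forall c, atlas c -> Ck m (chart_img c) (u \o chart_inv c).

Lemma smooth_funP (u : M -> R) : smooth_fun u <-> forall m, Ck_fun m u.
Proof.
split=> [su m c ac|H c ac]; first exact: (smooth_onP _ _).1 (su c ac) m.
by apply/smooth_onP => m; exact: H.
Qed.

Lemma Ck_fun_continuous m (u : M -> R) : Ck_fun m u -> continuous u.
Proof.
move=> um x; have ac := chart_at_atlas x; have cx := chart_at_dom x.
apply: (chart_continuous cx).
exact: Ck_cont (um _ ac) (chart_img_mem cx).
Qed.

Lemma transition_Ck1 c d (U : set V) : atlas c -> atlas d ->
  U `<=` c @` (chart_dom c `&` chart_dom d) ->
  forall j, Ck 1 U (fun y => transition c d y ord0 j).
Proof.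
move=> ac ad UU j; apply: Ck_sub UU _.
by move: (atlas_compatible ac ad j) => /smooth_onP; apply.
Qed.

Lemma chart_overlap_open c d : open (c @` (chart_dom c `&` chart_dom d)).
Proof.
have -> : c @` (chart_dom c `&` chart_dom d) =
    [set y | chart_img c y /\ chart_dom d (chart_inv c y)].
  apply/seteqP; split=> [_ [x [cx dx] <-]|y [cy dy]].
    by split; [exact: chart_img_mem|rewrite chart_mapK].
  exists (chart_inv c y); last exact: chart_invK.
  by split => //; exact: chart_inv_dom.
rewrite openE => y [cy dy]; apply: filterI; first exact: chart_img_near.
by apply: chart_inv_near => //; exact: chart_dom_near.
Qed.

Lemma overlap_mem c d x : chart_dom c x -> chart_dom d x ->
  (c @` (chart_dom c `&` chart_dom d)) (c x).
Proof. by move=> cx dx; exists x. Qed.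

Lemma compact_closed_manifold (K : set M) : compact K -> closed K.
Proof. exact: (compact_closed (@manifold_hausdorff _ _ M)). Qed.

Definition supported_in (K : set M) (f : M -> R) : Prop :=
  forall x, ~ K x -> f x = 0.

(** In this form compact support passes to products and to operators that do not enlarge supports,
    without handling closures. The converse uses that compact sets of a Hausdorff space are
    closed. *)
Lemma compactly_supportedP (f : M -> R) :
  compactly_supported f <-> exists2 K, compact K & supported_in K f.
Proof.
split=> [cf|[K cK Kf]].
  exists (closure [set x | f x != 0]) => // x nx.
  by apply: contrapT => /eqP fx; apply: nx; exact: subset_closure.
apply: (subclosed_compact _ cK); first exact: closed_closure.
rewrite [X in _ `<=` X](closure_id K).1; last exact: compact_closed_manifold.
by apply: closureS => x /eqP fx; apply: contrapT => nx; apply: fx; exact: Kf.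
Qed.

Lemma chart_img_compact c (K : set M) : compact K -> K `<=` chart_dom c ->
  compact (c @` K).
Proof.
move=> cK Kc; apply: continuous_compact => //.
by apply: continuous_in_subspaceT => x; rewrite inE => /Kc; exact: chart_map_cont.
Qed.

Lemma chart_inv_compact c (K : set V) : compact K -> K `<=` chart_img c ->
  compact (chart_inv c @` K).
Proof.
move=> cK Kc; apply: continuous_compact => //.
by apply: continuous_in_subspaceT => x; rewrite inE => /Kc; exact: chart_inv_cont.
Qed.

End Charts.

(** * Bump functions and partitions of unity on the manifold *)

Section PartitionOfUnity.
Variables (R : realType) (n : nat) (M : smooth_manifold R n).
Local Notation V := 'rV[R]_n.
Implicit Types (c d : chart R n M) (x : M) (y : V).

(** In another chart d, a point of the overlap is handled by composition with the transition map. At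
    a point outside the domain of c the function vanishes nearby, because K is closed in the
    Hausdorff space M. *)
Lemma chart_extend_Ck1 c (f : V -> R) (K : set M) : atlas c -> Ck 1 (chart_img c) f ->
  compact K -> K `<=` chart_dom c -> supported_in K ((f \o c) \_ (chart_dom c)) ->
  Ck_fun 1 ((f \o c) \_ (chart_dom c)).
Proof.
move=> ac f1 cK Kc Kf d ad y dy; set v := _ \_ _.
have [cx|ncx] := pselect (chart_dom c (chart_inv d y)).
  pose U := d @` (chart_dom d `&` chart_dom c).
  have oU : open U by exact: chart_overlap_open.
  have Uy : U y by exists (chart_inv d y); [split => //; exact: chart_inv_dom|exact: chart_invK].
  have H : Ck 1 U (f \o transition d c).
    apply: (@Ck1_comp _ _ _ _ (chart_img c)) => //.
    - exact: chart_img_open.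
    - exact: transition_Ck1.
    - by move=> z [x [dx cx'] <-]; rewrite /transition /= chart_mapK//; exact: chart_img_mem.
  apply: Ck_at_near (H y Uy); apply: (near_open oU Uy) => z [x [dx cx'] <-].
  by rewrite /v /transition /= patchE chart_mapK// mem_set.
apply: Ck_at_near (@Ck_cst R n 1 setT 0 y I).
have : \forall x \near chart_inv d y, (~` K) x.
  apply: open_nbhs_nbhs; split; last by move/Kc.
  by apply: closed_openC; exact: compact_closed_manifold.
by move/(chart_inv_near dy); apply: filterS => z nK; rewrite /v /= Kf.
Qed.

Lemma closed_ball_compact (a : V) (r : R) : compact [set y : V | `|y - a| <= r].
Proof.
apply: bounded_closed_compact.
  exists (r + `|a|); split; first exact: num_real.
  move=> x rx y /= yr; apply: le_trans (ltW rx).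
  by rewrite -[y](subrK a) (le_trans (ler_normD _ _))// lerD2r.
apply: (@preimage_closed _ _ (fun y : V => `|y - a|) [set t : R | t <= r]).
  move=> z _; apply: (@continuous_comp _ _ _ (fun y => y - a) (@Num.Def.normr R V)).
    by apply: (@continuousB _ _ _ id (fun=> a)); [move=> ?|exact: cst_continuous].
  exact: norm_continuous.
exact: closed_le.
Qed.

(** The strict bound at x0 makes the set where v exceeds 1 an open neighbourhood of x0, as the
    covering argument for partitions of unity needs. Prescribing N confines a test function to a
    region where a sign is known. *)
Lemma manifold_bump c x0 (N : set M) : atlas c -> chart_dom c x0 ->
  (\forall x \near x0, N x) ->
  exists v : M -> R, [/\ Ck_fun 1 v, (forall x, 0 <= v x), 1 < v x0 &
    exists K : set M, [/\ compact K, K `<=` chart_dom c, K `<=` N & supported_in K v]].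
Proof.
move=> ac cx Nx.
have : \forall y \near c x0, chart_img c y /\ N (chart_inv c y).
  apply: filterI; first exact/chart_img_near/chart_img_mem.
  by apply: chart_inv_near; rewrite ?chart_mapK//; exact: chart_img_mem.
move=> /nbhs_ballP[e /= e0 He].
pose a := c x0; pose r := e / 2; have r0 : 0 < r by rewrite divr_gt0.
pose K1 := [set y : V | `|y - a| <= r].
have K1e y : K1 y -> chart_img c y /\ N (chart_inv c y).
  move=> yr; apply: He; rewrite -ball_normE /= distrC (le_lt_trans yr)// /r; lra.
have cK1 : compact K1 by exact: closed_ball_compact.
pose K := chart_inv c @` K1.
have Kc : K `<=` chart_dom c.
  by move=> _ [y /K1e[cy _] <-]; exact: chart_inv_dom.
have cK : compact K by apply: chart_inv_compact => // y /K1e[].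
pose v := (ball_bump a r \o c) \_ (chart_dom c).
have Kv : supported_in K v.
  move=> x nKx; rewrite /v patchE; case: ifPn => // /set_mem dx /=.
  apply/eqP; apply: contraPT nKx => /(ball_bump_out r0) ha nk.
  by apply: nk; exists (c x) => //; rewrite chart_mapK.
exists v; split.
- apply: chart_extend_Ck1 Kv => //.
  by apply: Ck_sub (Ck1_ball_bump a r).
- by move=> x; rewrite /v patchE; case: ifP => // _; exact: ball_bump_ge0.
- by rewrite /v patchE mem_set//; exact: ball_bump_center.
- by exists K; split => // _ [y /K1e[_ Ny] <-].
Qed.

(** The identity is asked on K alone, since the functions to be split vanish off K; a finite
    subcover by the sets where a bump exceeds 1 then suffices, and s lists its centres. *)
Lemma partition_of_unity (K : set M) : compact K ->
  exists (s : seq M) (rho : M -> M -> R) (KK : M -> set M),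
    (forall p, [/\ Ck_fun 1 (rho p), compact (KK p),
      KK p `<=` chart_dom (chart_at p) & supported_in (KK p) (rho p)]) /\
    (forall x, K x -> \sum_(p <- s) rho p x = 1).
Proof.
move=> cK.
have /choice[chi Hchi] : forall p : M, exists v : (M -> R) * set M,
    [/\ Ck_fun 1 v.1, (forall x, 0 <= v.1 x), 1 < v.1 p &
    [/\ compact v.2, v.2 `<=` chart_dom (chart_at p) & supported_in v.2 v.1]].
  move=> p; have [] := @manifold_bump (chart_at p) p setT (chart_at_atlas p) (chart_at_dom p).
    exact: filterT.
  by move=> v [v1 v2 v3 [L [L1 L2 _ L3]]]; exists (v, L).
have ch1 p : Ck_fun 1 (chi p).1 by have [] := Hchi p.
have ch0 p x : 0 <= (chi p).1 x by have [_ + _ _] := Hchi p.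
pose W p := [set x | 1 < (chi p).1 x].
have oW p : open (W p).
  rewrite openE => x Wx; apply: (near_gt _ Wx).
  exact: (Ck_fun_continuous (ch1 p)).
have cKc : cover_compact K by rewrite -compact_cover.
have [] := cKc M setT W.
- by move=> p _; exact: oW.
- by move=> x _; exists x => //; have [] := Hchi x.
move=> D _ KD.
pose s := finmap.enum_fset D.
pose w x := \sum_(p <- s) (chi p).1 x.
have w0 x : 0 <= w x by apply: sumr_ge0 => p _; exact: ch0.
(* positive everywhere, and equal to w where w >= 1 *)
pose den x := w x + pos_sq (1 - w x).
have den0 x : 0 < den x.
  have := w0 x; rewrite le_eqVlt => /orP[/eqP e|wx].
    by rewrite /den -e add0r subr0 pos_sqE// expr1n.
  by apply: ltr_wpDr => //; exact: pos_sq_ge0.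
have wK x : K x -> den x = w x.
  move=> /KD[p pD /= Wp]; rewrite /den pos_sq0 ?addr0// subr_le0.
  rewrite /w (big_rem p)//= ; apply: le_trans (ltW Wp) _.
  by rewrite lerDl sumr_ge0.
have w1 : Ck_fun 1 w.
  move=> c ac; apply: (@Ck_sum _ _ 1 _ _ _ _ (fun p => (chi p).1 \o chart_inv c)) => [|p _].
    exact: chart_img_open.
  exact: ch1.
have den1 : Ck_fun 1 den.
  move=> c ac; have oc := @chart_img_open _ _ _ c.
  apply: CkD => //; first exact: w1.
  apply: Ck1_pos_sq => //; apply: CkB => //; first exact: Ck_cst.
  exact: w1.
exists s, (fun p x => (chi p).1 x * (den x)^-1), (fun p => (chi p).2); split.
  move=> p; have [_ _ _ [k1 k2 k3]] := Hchi p; split; [|exact: k1|exact: k2|].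
    move=> c ac; have oc := @chart_img_open _ _ _ c.
    apply: CkM => //; first exact: ch1.
    by apply: Ck_inv => //; [move=> y _; rewrite /= gt_eqF|exact: den1].
  by move=> x nx; rewrite (k3 x nx) mul0r.
move=> x Kx; rewrite -mulr_suml -/(w x) wK// mulfV//.
by rewrite -wK// gt_eqF.
Qed.

End PartitionOfUnity.

(** * The Riemannian measure in charts *)

Section RiemannianMeasure.
Variables (R : realType) (n : nat) (M : smooth_manifold R n).
Variable g : riemannian_metric M.
Variable dvol : {measure set (borel M) -> \bar R}.
Hypothesis hdvol : is_riemannian_volume g dvol.
Local Notation V := 'rV[R]_n.
Implicit Types (c d : chart R n M) (x : M) (y : V).

Lemma gram_posdef c y : atlas c -> chart_img c y -> posdef (gram g c y).
Proof. by move=> ac cy v; exact: gram_pos. Qed.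

Lemma gram_unit c y : atlas c -> chart_img c y -> gram g c y \in unitmx.
Proof. by move=> ac cy; apply: posdef_unit; exact: gram_posdef. Qed.

Lemma gram_Ck m c i j : atlas c -> Ck m (chart_img c) (fun y => gram g c y i j).
Proof. by move=> ac; have /smooth_onP := gram_smooth g ac i j; apply. Qed.

Lemma gram_inv_Ck m c i j : atlas c ->
  Ck m (chart_img c) (fun y => invmx (gram g c y) i j).
Proof.
move=> ac; apply: Ck_invmx; first exact: chart_img_open.
- by move=> y; exact: gram_unit.
- by move=> a b; exact: gram_Ck.
Qed.

Lemma gram_inv_sym c y i j : atlas c -> chart_img c y ->
  invmx (gram g c y) i j = invmx (gram g c y) j i.
Proof.
move=> ac cy; have := trmx_inv (gram g c y); rewrite gram_sym// => E.
by rewrite -[in LHS]E mxE.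
Qed.

Lemma vol_density_gt0 c y : atlas c -> chart_img c y -> 0 < vol_density g c y.
Proof.
by move=> ac cy; rewrite /vol_density sqrtr_gt0 posdef_det_gt0//; exact: gram_posdef.
Qed.

Lemma vol_density_Ck m c : atlas c -> Ck m (chart_img c) (vol_density g c).
Proof.
move=> ac; apply: Ck_sqrt; first exact: chart_img_open.
  by move=> y cy; apply: posdef_det_gt0; exact: gram_posdef.
by apply: Ck_det; [exact: chart_img_open|move=> i j; exact: gram_Ck].
Qed.

(** The integrand on the coordinate side of [is_riemannian_volume], for real-valued f. *)
Definition chart_pullback c (f : M -> R) : V -> R :=
  (fun y => vol_density g c y * f (chart_inv c y)) \_ (chart_img c).

Lemma continuous_borel_measurable (f : M -> R) : continuous f ->
  measurable_fun [set: borel M] (f : borel M -> R).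
Proof.
move=> cf; apply: (measurability _ (RGenOInfty.measurableE R)).
move=> _ [_ [a ->] <-]; rewrite setTI; apply: sub_sigma_algebra.
apply: open_comp; last by rewrite set_itvE; exact: open_gt.
by move=> x _; exact: cf.
Qed.

Section OneChart.
Variables (c : chart R n M) (K : set M).
Hypotheses (ac : atlas c) (cK : compact K) (Kc : K `<=` chart_dom c).

(** The radius does not depend on f: linearity of [Rn_integral] requires a common box for the
    functions it combines. *)
Lemma chart_pullback_Cc : exists2 B : R, 0 < B & forall f : M -> R,
  continuous f -> supported_in K f -> Cc B (chart_pullback c f).
Proof.
have cK1 := chart_img_compact cK Kc.
have [B B0 HB] := compact_box cK1; exists B => // f cf Kf; split.
  move=> y; have := @Ck_extend R n 0 (chart_img c) (c @` K)
    (fun y => vol_density g c y * f (chart_inv c y)) _ _ _ _ _ y I.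
  case=> //.
  - exact: chart_img_open.
  - by apply: compact_closed => //; exact: norm_hausdorff.
  - by move=> _ [x Kx <-]; exact/chart_img_mem/Kc.
  - move=> z cz nKz; rewrite Kf ?mulr0// => Kx; apply: nKz.
    by exists (chart_inv c z) => //; exact: chart_invK.
  apply: CkM; [exact: chart_img_open|exact: vol_density_Ck|].
  by move=> z cz; split => //; apply: continuous_chart => //; exact: cf.
move=> y By; rewrite /chart_pullback patchE; case: ifPn => // /set_mem cy.
rewrite Kf ?mulr0// => Kx; move: By; rewrite ltNge => /negP; apply; apply: HB.
by exists (chart_inv c y) => //; exact: chart_invK.
Qed.

Lemma chart_integral_ge0 (f : M -> R) : continuous f -> supported_in K f ->
  (forall x, 0 <= f x) ->
  (\int[dvol]_x (f x)%:E = (Rn_integral (chart_pullback c f))%:E)%E.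
Proof.
move=> cf Kf f0; have [B B0 HB] := chart_pullback_Cc.
rewrite -(integral_RnE B0 (HB f cf Kf)).
have -> : (fun y => (chart_pullback c f y)%:E) =
  ((fun y => ((vol_density g c y)%:E * (f (chart_inv c y))%:E)%E) \_ (chart_img c)).
  by apply/funext => y; rewrite /chart_pullback !patchE; case: ifP.
rewrite -(hdvol ac (f := fun x => (f x)%:E)); last 2 first.
- by apply/measurable_EFinP; exact: continuous_borel_measurable.
- by move=> x; rewrite lee_fin.
rewrite [RHS]integral_mkcond; congr (integral _ _ _); apply/funext => x.
rewrite patchE; case: ifPn => // nx; rewrite Kf// => /Kc dx.
by move: nx; rewrite mem_set.
Qed.

Lemma chart_integrable_ge0 (f : M -> R) : continuous f -> supported_in K f ->
  (forall x, 0 <= f x) -> dvol.-integrable setT (EFin \o f).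
Proof.
move=> cf Kf f0; apply/integrableP; split.
  by apply/measurable_EFinP; exact: continuous_borel_measurable.
under eq_integral do rewrite gee0_abs ?lee_fin//.
by rewrite chart_integral_ge0// ltry.
Qed.

(** [is_riemannian_volume] concerns nonnegative functions, so signed integrands are split into
    positive and negative parts, which stay continuous and supported in K. *)
Let fpos (f : M -> R) x := Num.max 0 (f x).

Let fposP (f : M -> R) : continuous f -> supported_in K f ->
  [/\ continuous (fpos f), supported_in K (fpos f) & forall x, 0 <= fpos f x].
Proof.
move=> cf Kf; split.
- move=> x; apply: (@continuous_comp _ _ _ f (fun t : R => Num.max 0 t)).
    exact: cf.
  exact: max0_continuous.
- by move=> x /Kf fx; rewrite /fpos fx maxxx.
- by move=> x; rewrite /fpos le_max lexx.
Qed.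

Let fposB (f : M -> R) x : f x = fpos f x - fpos (fun x => - f x) x.
Proof. by rewrite /fpos; case: (leP 0 (f x)) => h1; case: (leP 0 (- f x)) => h2; lra. Qed.

Let negP (f : M -> R) : continuous f -> supported_in K f ->
  continuous (fun x => - f x) /\ supported_in K (fun x => - f x).
Proof.
move=> cf Kf; split; last by move=> x /Kf ->; rewrite oppr0.
by move=> x; apply: continuousN; exact: cf.
Qed.

Lemma chart_integrable (f : M -> R) : continuous f -> supported_in K f ->
  dvol.-integrable setT (EFin \o f).
Proof.
move=> cf Kf; have [cf' Kf'] := negP cf Kf.
have [c1 k1 p1] := fposP cf Kf; have [c2 k2 p2] := fposP cf' Kf'.
have := integrableB measurableT (chart_integrable_ge0 c1 k1 p1) (chart_integrable_ge0 c2 k2 p2).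
congr (integrable _ _ _); apply/funext => x.
by rewrite /= -EFinB -fposB.
Qed.

Lemma chart_integral (f : M -> R) : continuous f -> supported_in K f ->
  (\int[dvol]_x (f x)%:E = (Rn_integral (chart_pullback c f))%:E)%E.
Proof.
move=> cf Kf; have [cf' Kf'] := negP cf Kf.
have [c1 k1 p1] := fposP cf Kf; have [c2 k2 p2] := fposP cf' Kf'.
have [B B0 HB] := chart_pullback_Cc.
have -> : (\int[dvol]_x (f x)%:E = \int[dvol]_x ((fpos f x)%:E - (fpos (fun x => - f x)%R x)%:E))%E.
  by apply: eq_integral => x _; rewrite -EFinB -fposB.
rewrite integralB_EFin//; last 2 first.
- exact: chart_integrable_ge0.
- exact: chart_integrable_ge0.
rewrite !chart_integral_ge0// -EFinB; congr (_%:E).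
have := Rn_integral_lin B0 1 (-1) (HB _ c1 k1) (HB _ c2 k2).
rewrite mul1r mulN1r => <-; congr Rn_integral; apply/funext => y.
rewrite mul1r mulN1r /chart_pullback !patchE; case: ifP => _; last by rewrite subrr.
by rewrite -mulrBr -fposB.
Qed.

Lemma chart_integral_gt0 (f : M -> R) x0 : continuous f -> supported_in K f ->
  (forall x, 0 <= f x) -> 0 < f x0 -> (0 < \int[dvol]_x (f x)%:E)%E.
Proof.
move=> cf Kf f0 fx0; have [B B0 HB] := chart_pullback_Cc.
have dx0 : chart_dom c x0.
  apply: Kc; apply: contrapT => /Kf fx; by move: fx0; rewrite fx ltxx.
rewrite chart_integral// lte_fin; apply: (@Rn_integral_gt0 _ B B0 _ _ (c x0)).
- exact: HB.
- move=> y; rewrite /chart_pullback patchE; case: ifPn => // /set_mem cy.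
  by rewrite mulr_ge0// ltW// vol_density_gt0.
- have cx := chart_img_mem dx0.
  by rewrite /chart_pullback patchE mem_set// chart_mapK// mulr_gt0// vol_density_gt0.
Qed.

End OneChart.

(** Cutting f by a partition of unity leaves finitely many pieces, each integrable in its own
    chart. *)
Lemma compact_integrable (K : set M) (f : M -> R) : compact K -> continuous f ->
  supported_in K f -> dvol.-integrable setT (EFin \o f).
Proof.
move=> cK cf Kf.
have [s [rho [KK [Hrho sum1]]]] := partition_of_unity cK.
have E : EFin \o f = (fun x => \sum_(p <- s) (rho p x * f x)%:E)%E.
  apply/funext => x /=; rewrite sumEFin -mulr_suml.
  have [Kx|nKx] := pselect (K x); first by rewrite sum1// mul1r.
  by rewrite Kf// mulr0.
rewrite E; apply: integrable_sum => // p _.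
have [r1 r2 r3 r4] := Hrho p.
have := @chart_integrable _ _ (chart_at_atlas p) r2 r3 (fun x => rho p x * f x).
apply; last by move=> x /r4 ->; rewrite mul0r.
by move=> x; apply: continuousM; [exact: (Ck_fun_continuous r1)|exact: cf].
Qed.

End RiemannianMeasure.

(** * Green's formula and the Laplacian *)

Section ChartLaplacian.
Variables (R : realType) (n : nat) (M : smooth_manifold R n).
Variable g : riemannian_metric M.
Local Notation V := 'rV[R]_n.
Implicit Types (c d : chart R n M) (x : M) (y : V) (u v : M -> R).

Lemma Ck_fun_pred m u : Ck_fun m.+1 u -> Ck_fun m u.
Proof. by move=> um c ac; exact/Ck_pred/um. Qed.

(* [lap_chart c u y] and [grad_chart c u v y] are [laplacian g u x] and
   [grad_inner g u v x] computed at y = c x in an arbitrary chart c. *)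
Definition flux c u (i : 'I_n) : V -> R := fun z =>
  vol_density g c z *
  \sum_(j < n) invmx (gram g c z) i j * partial j (u \o chart_inv c) z.

Definition lap_chart c u : V -> R := fun y =>
  (vol_density g c y)^-1 * \sum_(i < n) partial i (flux c u i) y.

Definition grad_chart c u v : V -> R := fun y =>
  \sum_(i < n) \sum_(j < n) invmx (gram g c y) i j *
    partial i (u \o chart_inv c) y * partial j (v \o chart_inv c) y.

Lemma flux_Ck m c u i : atlas c -> Ck_fun m.+1 u -> Ck m (chart_img c) (flux c u i).
Proof.
move=> ac um; have oc := @chart_img_open _ _ _ c.
apply: CkM => //; first exact: vol_density_Ck.
apply: Ck_sum => // j _; apply: CkM => //; first exact: gram_inv_Ck.
by apply: Ck_partial; exact: um.
Qed.

Lemma lap_chart_Ck m c u : atlas c -> Ck_fun m.+2 u -> Ck m (chart_img c) (lap_chart c u).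
Proof.
move=> ac um; have oc := @chart_img_open _ _ _ c.
apply: CkM => //.
  apply: Ck_inv => //; last exact: vol_density_Ck.
  by move=> y cy; rewrite gt_eqF// vol_density_gt0.
by apply: Ck_sum => // i _; apply: Ck_partial; exact: flux_Ck.
Qed.

Lemma grad_chart_Ck m c u v : atlas c -> Ck_fun m.+1 u -> Ck_fun m.+1 v ->
  Ck m (chart_img c) (grad_chart c u v).
Proof.
move=> ac um vm; have oc := @chart_img_open _ _ _ c.
apply: Ck_sum => // i _; apply: Ck_sum => // j _.
apply: CkM => //; last by apply: Ck_partial; exact: vm.
apply: CkM => //; first exact: gram_inv_Ck.
by apply: Ck_partial; exact: um.
Qed.

Lemma grad_chart_sym c u v y : atlas c -> chart_img c y ->
  grad_chart c u v y = grad_chart c v u y.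
Proof.
move=> ac cy; rewrite /grad_chart exchange_big; apply: eq_bigr => i _.
by apply: eq_bigr => j _; rewrite gram_inv_sym// mulrAC.
Qed.

Definition drow c u y : V := \row_i partial i (u \o chart_inv c) y.

Lemma grad_chartE c u v y : grad_chart c u v y =
  (drow c u y *m invmx (gram g c y) *m (drow c v y)^T) ord0 ord0.
Proof.
rewrite mxE /grad_chart exchange_big; apply: eq_bigr => j _.
rewrite mxE mulr_suml; apply: eq_bigr => i _.
by rewrite !mxE [X in X * _]mulrC.
Qed.

(** The chain rule for differentials: with tangent vectors as rows, covectors pick up the transposed
    Jacobian. *)
Lemma drow_change c d u x : atlas c -> atlas d -> chart_dom c x -> chart_dom d x ->
  Ck_fun 1 u ->
  drow c u (c x) = drow d u (d x) *m ('J (transition c d) (c x))^T.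
Proof.
move=> ac ad cx dx u1.
pose U := c @` (chart_dom c `&` chart_dom d).
have oU : open U := @chart_overlap_open _ _ _ _ _.
have Ux : U (c x) := overlap_mem cx dx.
have t1 := @transition_Ck1 _ _ _ c d U ac ad (@subset_refl _ U).
have dt : differentiable (transition c d) (c x).
  by apply: row_differentiable => j; exact: (Ck1_differentiable oU (t1 j) Ux).
have tx : transition c d (c x) = d x by rewrite /transition /= chart_mapK.
have du : differentiable (u \o chart_inv d) (transition c d (c x)).
  rewrite tx; apply: (Ck1_differentiable (@chart_img_open _ _ _ d) (u1 d ad)).
  exact: chart_img_mem.
apply/rowP => i; rewrite !mxE.
have -> : partial i (u \o chart_inv c) (c x) =
          partial i ((u \o chart_inv d) \o transition c d) (c x).
  apply: (@partial_ext _ _ U) => // z [x' [cx' dx'] <-].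
  by rewrite /transition /= !chart_mapK.
rewrite /partial derive_comp_row//; apply: eq_bigr => j _.
rewrite !mxE tx mulrC; congr (_ * _).
by rewrite -derive_row// deriveE.
Qed.

Lemma grad_chart_indep c d u v x : atlas c -> atlas d -> chart_dom c x ->
  chart_dom d x -> Ck_fun 1 u -> Ck_fun 1 v ->
  grad_chart c u v (c x) = grad_chart d u v (d x).
Proof.
move=> ac ad cx dx u1 v1; rewrite !grad_chartE.
rewrite (drow_change ac ad cx dx u1) (drow_change ac ad cx dx v1).
set J := 'J _ _; set X := invmx (gram g c (c x)); set G := gram g d (d x).
have uGc := gram_unit g ac (chart_img_mem cx).
have uG : G \in unitmx := gram_unit g ad (chart_img_mem dx).
have E : gram g c (c x) = J *m G *m J^T by exact: gram_change.
(* J is a factor of the invertible matrix [gram g c (c x)], so the change formula can be inverted;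
   in the inverse metric the Jacobians of the two differentials cancel. *)
have uJ : J \in unitmx by move: uGc; rewrite E !unitmx_mul => /andP[/andP[]].
have E1 : J^T *m X *m J = invmx G.
  have H : J *m (G *m (J^T *m X *m J)) = J *m 1%:M.
    by rewrite !mulmxA -E mulmxV// mul1mx mulmx1.
  have : G *m (J^T *m X *m J) = 1%:M.
    by move: (congr1 (mulmx (invmx J)) H); rewrite !mulKmx.
  by move/(congr1 (mulmx (invmx G))); rewrite mulKmx// mulmx1.
by rewrite trmx_mul trmxK -E1 !mulmxA.
Qed.

End ChartLaplacian.

(** * Green's formula in one chart and chart independence *)

Section ChartGreen.
Variables (R : realType) (n : nat) (M : smooth_manifold R n).
Variable g : riemannian_metric M.
Variable dvol : {measure set (borel M) -> \bar R}.
Hypothesis hdvol : is_riemannian_volume g dvol.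
Local Notation V := 'rV[R]_n.
Implicit Types (c d : chart R n M) (x : M) (y : V) (u v : M -> R).

Lemma supported_near (K : set M) v x : compact K -> supported_in K v -> ~ K x ->
  \forall x' \near x, v x' = 0.
Proof.
move=> cK Kv nKx; have : \forall x' \near x, (~` K) x'.
  apply: open_nbhs_nbhs; split => //.
  by apply: closed_openC; exact: compact_closed_manifold.
by apply: filterS => x' /Kv.
Qed.

Lemma supported_continuous (U K : set M) v : compact K -> K `<=` U ->
  supported_in K v -> (forall x, U x -> {for x, continuous v}) -> continuous v.
Proof.
move=> cK KU Kv Uv x; have [Ux|nUx] := pselect (U x); first exact: Uv.
have nKx : ~ K x by move/KU.
apply: (@near_continuous _ _ (fun=> 0)); last exact: cst_continuous.
by apply: filterS (supported_near cK Kv nKx) => x' ->.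
Qed.

Lemma grad_chart_out c u v (K : set M) x : compact K -> supported_in K v -> ~ K x ->
  chart_dom c x -> grad_chart g c u v (c x) = 0.
Proof.
move=> cK Kv nKx cx; apply: big1 => i _; apply: big1 => j _.
suff -> : partial j (v \o chart_inv c) (c x) = 0 by rewrite mulr0.
rewrite -(partial_cst j 0 (c x)); apply: near_eq_derive.
apply: (@chart_inv_near _ _ _ c (c x) (fun x => v x = 0)); first exact: chart_img_mem.
by rewrite chart_mapK//; exact: supported_near nKx.
Qed.

Lemma Rn_integral_sum0 B (I : Type) (r : seq I) (F : I -> V -> R) : 0 < B ->
  (forall i, Cc B (F i)) -> (forall i, Rn_integral (F i) = 0) ->
  Rn_integral (fun y => \sum_(i <- r) F i y) = 0.
Proof.
move=> B0 CF F0.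
suff [] : Cc B (fun y => \sum_(i <- r) F i y) /\
          Rn_integral (fun y => \sum_(i <- r) F i y) = 0 by [].
elim: r => [|i r [C1 I1]].
  have -> : (fun y => \sum_(i <- [::]) F i y) = fun=> 0.
    by apply/funext => y; rewrite big_nil.
  by split; [split => //; move=> y; exact: cst_continuous|exact: Rn_integral0].
have -> : (fun y => \sum_(i <- i :: r) F i y) =
    fun y => 1 * F i y + 1 * \sum_(i <- r) F i y.
  by apply/funext => y; rewrite big_cons !mul1r.
split; first exact: Cc_lin.
by rewrite (Rn_integral_lin B0 1 1 (CF i) C1) F0 I1 !mulr0 addr0.
Qed.

(* The integrand of Green's formula in the chart c. *)
Definition green_term c u v : M -> R :=
  (fun x => lap_chart g c u (c x) * v x + grad_chart g c u v (c x)) \_ (chart_dom c).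

Section Green.
Variables (c : chart R n M) (u v : M -> R) (K : set M).
Hypotheses (ac : atlas c) (u2 : Ck_fun 2 u) (v1 : Ck_fun 1 v).
Hypotheses (cK : compact K) (Kc : K `<=` chart_dom c) (Kv : supported_in K v).

Lemma green_term_supported : supported_in K (green_term c u v).
Proof.
move=> x nKx; rewrite /green_term patchE; case: ifPn => // /set_mem cx.
by rewrite Kv// mulr0 add0r (grad_chart_out u cK Kv).
Qed.

Lemma green_term_continuous : continuous (green_term c u v).
Proof.
apply: (supported_continuous cK Kc green_term_supported) => x cx.
apply: (chart_continuous cx).
apply: (@near_continuous _ _ (fun y => lap_chart g c u y * v (chart_inv c y) +
  grad_chart g c u v y)).
  apply: filterS (chart_img_near (chart_img_mem cx)) => y cy /=.
  by rewrite /green_term patchE mem_set ?chart_invK//; exact: chart_inv_dom.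
have cx' := chart_img_mem cx.
apply: continuousD.
  apply: continuousM; first exact: Ck_cont (@lap_chart_Ck _ _ _ g 0 _ _ ac u2) cx'.
  exact: Ck_cont (v1 ac) cx'.
exact: Ck_cont (@grad_chart_Ck _ _ _ g 0 _ _ _ ac (Ck_fun_pred u2) v1) cx'.
Qed.

(** Multiplied by the volume density, the integrand is the coordinate divergence of the field with
    components [flux g c u i] times v, extended by zero, and each partial derivative integrates to
    0. *)
Lemma chart_green : (\int[dvol]_x (green_term c u v x)%:E = 0)%E.
Proof.
rewrite (chart_integral hdvol ac cK Kc green_term_continuous green_term_supported).
congr (_%:E).
have oc := @chart_img_open _ _ _ c.
pose K1 := c @` K.
have cK1 : compact K1 by exact: chart_img_compact.
have clK1 : closed K1 by apply: compact_closed cK1; exact: norm_hausdorff.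
have K1c : K1 `<=` chart_img c by move=> _ [x Kx <-]; exact/chart_img_mem/Kc.
have vK1 y : chart_img c y -> ~ K1 y -> v (chart_inv c y) = 0.
  move=> cy nKy; apply: Kv => Kx; apply: nKy.
  by exists (chart_inv c y) => //; exact: chart_invK.
have [B B0 HB] := compact_box cK1.
pose X i := (fun y => flux g c u i y * v (chart_inv c y)) \_ (chart_img c).
have X1 i : Ck 1 setT (X i).
  apply: (Ck_extend oc clK1 K1c) => [y cy nK|]; first by rewrite vK1// mulr0.
  by apply: CkM => //; [exact: flux_Ck|exact: v1].
have XK y i : ~ K1 y -> X i y = 0.
  by move=> nK; rewrite /X patchE; case: ifPn => // /set_mem cy; rewrite vK1// mulr0.
have Xb i : box_supported B (X i).
  by move=> y By; apply: XK => /HB; rewrite leNgt By.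
have -> : chart_pullback g c (green_term c u v) = fun y => \sum_i partial i (X i) y.
  apply/funext => y; rewrite /chart_pullback patchE; case: ifPn => [/set_mem cy|ncy].
    rewrite /green_term patchE mem_set ?chart_invK//; last exact: chart_inv_dom.
    transitivity (\sum_i partial i (fun z => flux g c u i z * v (chart_inv c z)) y).
      have -> : \sum_i partial i (fun z => flux g c u i z * v (chart_inv c z)) y =
        \sum_i (flux g c u i y * partial i (v \o chart_inv c) y +
          v (chart_inv c y) * partial i (flux g c u i) y).
        apply: eq_bigr => i _; apply: (@partialM _ _ i (flux g c u i) (v \o chart_inv c) y).
          exact: (@Ck_derivable _ _ 0 _ _ _ i (@flux_Ck _ _ _ g 1 _ _ _ ac u2) cy).
        exact: (@Ck_derivable _ _ 0 _ _ _ i (v1 ac) cy).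
      rewrite big_split /= -mulr_sumr [RHS]addrC mulrDr; congr (_ + _).
        rewrite /lap_chart mulrA mulrA mulfV ?mul1r 1?[RHS]mulrC//.
        by rewrite gt_eqF// vol_density_gt0.
      rewrite (grad_chart_sym _ _ _ ac cy) /grad_chart mulr_sumr; apply: eq_bigr => i _.
      rewrite /flux -mulrA; congr (_ * _); rewrite mulr_suml; apply: eq_bigr => j _.
      by rewrite mulrAC.
    apply: eq_bigr => i _; apply: (partial_ext i oc cy) => z cz.
    by rewrite /X patchE mem_set.
  (* Off the chart image the point lies in the open complement of K1, where all components of the
     field vanish. *)
  rewrite big1// => i _; rewrite -(partial_cst i 0 y).
  apply: (@partial_ext _ _ (~` K1)); first exact: closed_openC.
    by move=> /K1c Ky; move: ncy; rewrite mem_set.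
  by move=> z nK; exact: XK.
apply: (Rn_integral_sum0 _ B0) => i; first exact: Cc_partial.
exact: Rn_integral_partial B0 (X1 i) (Xb i).
Qed.

End Green.

(* Two charts give the same Laplacian because they give the same integrals
   against test functions, by Green's formula in either chart. *)
Lemma lap_chart_indep c d u x0 : atlas c -> atlas d -> chart_dom c x0 ->
  chart_dom d x0 -> Ck_fun 2 u -> lap_chart g c u (c x0) = lap_chart g d u (d x0).
Proof.
wlog: c d / lap_chart g d u (d x0) < lap_chart g c u (c x0).
  move=> W ac ad cx dx u2; have [h|h|//] := ltgtP (lap_chart g c u (c x0)) (lap_chart g d u (d x0)).
    by apply/esym/W.
  exact: W.
move=> h0 ac ad cx dx u2; exfalso.
have [h hE] : exists h : M -> R, h = fun x => lap_chart g c u (c x) - lap_chart g d u (d x).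
  by eexists.
have lapc e x : atlas e -> chart_dom e x ->
    {for x, continuous (fun x => lap_chart g e u (e x))}.
  move=> ae ex; apply: (@continuous_comp _ _ _ e (lap_chart g e u)).
    exact: chart_map_cont.
  exact: Ck_cont (@lap_chart_Ck _ _ _ g 0 _ _ ae u2) (chart_img_mem ex).
have ch x : chart_dom c x -> chart_dom d x -> {for x, continuous h}.
  by move=> cx' dx'; rewrite hE; apply: continuousB; exact: lapc.
have hx0 : 0 < h x0 by rewrite hE subr_gt0.
pose N x := [/\ chart_dom c x, chart_dom d x & 0 < h x].
have Nx0 : \forall x \near x0, N x.
  near=> x; split; near: x; [exact: chart_dom_near|exact: chart_dom_near|].
  exact: near_gt (ch _ cx dx) hx0.
have [v [v1 v0 vx0 [K [cK Kc KN Kv]]]] := manifold_bump ac cx Nx0.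
have Kd : K `<=` chart_dom d by move=> x /KN[].
have F1 := green_term_continuous ac u2 v1 cK Kc Kv.
have F2 := green_term_continuous ad u2 v1 cK Kd Kv.
have S1 := @green_term_supported c u v K cK Kv.
have S2 := @green_term_supported d u v K cK Kv.
(* The gradient terms cancel, so on K this is h v, with h > 0 there by the choice of N. Green's
   formula in both charts makes its integral 0, although it is positive at x0. *)
pose f x := green_term c u v x - green_term d u v x.
have fE x : K x -> f x = h x * v x.
  move=> Kx; have [cx' dx' _] := KN x Kx.
  rewrite /f /green_term !patchE !mem_set//.
  rewrite (grad_chart_indep g ac ad cx' dx' (Ck_fun_pred u2) v1) hE.
  have key (a b w q : R) : a * w + q - (b * w + q) = (a - b) * w by ring.
  exact: key.
have Kf : supported_in K f by move=> x nK; rewrite /f S1// S2// subrr.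
have cf : continuous f.
  by move=> x; apply: continuousB; [exact: F1|exact: F2].
have f0 x : 0 <= f x.
  have [Kx|nK] := pselect (K x); last by rewrite Kf.
  by have [_ _ hx] := KN x Kx; rewrite fE//; exact: mulr_ge0 (ltW hx) (v0 x).
have Kx0 : K x0 by apply: contrapT => /Kv e; move: vx0; rewrite e ltr10.
have fx0 : 0 < f x0 by rewrite fE//; exact: mulr_gt0 hx0 (lt_trans ltr01 vx0).
have := chart_integral_gt0 hdvol ac cK Kc cf Kf f0 fx0.
have -> : (\int[dvol]_x (f x)%:E = 0)%E.
  under eq_integral do rewrite /f EFinB.
  rewrite integralB_EFin//.
  - by rewrite (chart_green ac u2 v1 cK Kc Kv) (chart_green ad u2 v1 cK Kd Kv) sube0.
  - exact: (compact_integrable hdvol cK F1 S1).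
  - exact: (compact_integrable hdvol cK F2 S2).
by rewrite ltxx.
Unshelve. all: by end_near. Qed.

End ChartGreen.

Lemma partial_sum (R : realType) (n : nat) (I : Type) (r : seq I)
    (F : I -> 'rV[R]_n -> R) (i : 'I_n) y :
  (forall p, derivable (F p) y (basis_vec R i)) ->
  derivable (fun z => \sum_(p <- r) F p z) y (basis_vec R i) /\
  partial i (fun z => \sum_(p <- r) F p z) y = \sum_(p <- r) partial i (F p) y.
Proof.
move=> dF; elim: r => [|p r [d1 e1]].
  have -> : (fun z => \sum_(p <- [::]) F p z) = fun=> 0.
    by apply/funext => z; rewrite big_nil.
  by rewrite big_nil; split; [exact: derivable_cst|exact: partial_cst].
have -> : (fun z => \sum_(p <- p :: r) F p z) = fun z => F p z + \sum_(p <- r) F p z.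
  by apply/funext => z; rewrite big_cons.
rewrite big_cons -e1; split; first exact: (derivableD (dF p) d1).
exact: (partialD (dF p) d1).
Qed.

(** * Green's formula and self-adjointness on the manifold *)

Section Laplacian.
Variables (R : realType) (n : nat) (M : smooth_manifold R n).
Variable g : riemannian_metric M.
Variable dvol : {measure set (borel M) -> \bar R}.
Hypothesis hdvol : is_riemannian_volume g dvol.
Local Notation V := 'rV[R]_n.
Implicit Types (c d : chart R n M) (x : M) (y : V) (u v : M -> R).

(** Allows one chart to be kept in a neighbourhood of x, whereas the definition changes chart from
    point to point; the regularity of [laplacian g u] rests on this. *)
Lemma laplacianE c u x : atlas c -> chart_dom c x -> Ck_fun 2 u ->
  laplacian g u x = lap_chart g c u (c x).
Proof.
move=> ac cx u2.
exact: (lap_chart_indep hdvol (chart_at_atlas x) ac (chart_at_dom x) cx u2).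
Qed.

Lemma grad_innerE c u v x : atlas c -> chart_dom c x -> Ck_fun 1 u -> Ck_fun 1 v ->
  grad_inner g u v x = grad_chart g c u v (c x).
Proof.
move=> ac cx u1 v1.
exact: (grad_chart_indep g (chart_at_atlas x) ac (chart_at_dom x) cx u1 v1).
Qed.

Lemma laplacian_Ck m u : Ck_fun m.+2 u -> Ck_fun m (laplacian g u).
Proof.
move=> um c ac; have u2 : Ck_fun 2 u.
  by elim: m um => // m IH /Ck_fun_pred; exact: IH.
apply: (Ck_ext (@chart_img_open _ _ _ c)) (lap_chart_Ck g ac um) => y cy.
rewrite /= (laplacianE ac (chart_inv_dom cy) u2) chart_invK//.
Qed.

Lemma grad_inner_Ck m u v : Ck_fun m.+1 u -> Ck_fun m.+1 v ->
  Ck_fun m (grad_inner g u v).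
Proof.
have le1 (w : M -> R) : Ck_fun m.+1 w -> Ck_fun 1 w.
  by elim: m => // m IH /Ck_fun_pred; exact: IH.
move=> um vm c ac.
apply: (Ck_ext (@chart_img_open _ _ _ c)) (grad_chart_Ck g ac um vm) => y cy.
by rewrite /= (grad_innerE ac (chart_inv_dom cy) (le1 u um) (le1 v vm)) chart_invK.
Qed.

Lemma laplacian_smooth u : smooth_fun u -> smooth_fun (laplacian g u).
Proof.
move=> /smooth_funP su; apply/smooth_funP => m; apply: laplacian_Ck; exact: su.
Qed.

Lemma grad_chart_sum c u (I : Type) (r : seq I) (F : I -> M -> R) y : atlas c ->
  chart_img c y -> (forall p, Ck_fun 1 (F p)) ->
  grad_chart g c u (fun x => \sum_(p <- r) F p x) y =
  \sum_(p <- r) grad_chart g c u (F p) y.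
Proof.
move=> ac cy F1; rewrite /grad_chart [RHS]exchange_big; apply: eq_bigr => i _.
rewrite [RHS]exchange_big; apply: eq_bigr => j _ /=.
rewrite -mulr_sumr; congr (_ * _).
have [_ <-] := @partial_sum R n I r (fun p => F p \o chart_inv c) j y
  (fun p => @Ck_derivable _ _ 0 _ _ _ j (F1 p c ac) cy).
by [].
Qed.

(** The global expression and the one in the chart also agree outside the domain of c, where v
    vanishes in a neighbourhood and both are 0. *)
Lemma green_termE c u v (K : set M) x : atlas c -> Ck_fun 2 u -> Ck_fun 1 v ->
  compact K -> K `<=` chart_dom c -> supported_in K v ->
  laplacian g u x * v x + grad_inner g u v x = green_term g c u v x.
Proof.
move=> ac u2 v1 cK Kc Kv; rewrite /green_term patchE; case: ifPn => [/set_mem cx|ncx].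
  by rewrite (laplacianE ac cx u2) (grad_innerE ac cx (Ck_fun_pred u2) v1).
have nK : ~ K x by move=> /Kc dx; move: ncx; rewrite mem_set.
rewrite Kv// mulr0 add0r.
exact: (grad_chart_out g u cK Kv nK (chart_at_dom x)).
Qed.

Lemma integral_sum0 (I : Type) (r : seq I) (F : I -> M -> R) :
  (forall p, dvol.-integrable setT (EFin \o F p)) ->
  (forall p, \int[dvol]_x (F p x)%:E = 0)%E ->
  (\int[dvol]_x (\sum_(p <- r) F p x)%:E = 0)%E.
Proof.
move=> iF F0.
suff [] : dvol.-integrable setT (EFin \o (fun x => \sum_(p <- r) F p x)) /\
  (\int[dvol]_x (\sum_(p <- r) F p x)%:E = 0)%E by [].
elim: r => [|p r [i1 e1]].
  have -> : (fun x => \sum_(p <- [::]) F p x) = fun=> 0.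
    by apply/funext => x; rewrite big_nil.
  split; first exact: integrable0.
  by under eq_integral do rewrite big_nil; exact: integral0.
have E : (fun x => \sum_(p <- p :: r) F p x) = fun x => F p x + \sum_(p <- r) F p x.
  by apply/funext => x; rewrite big_cons.
rewrite E; split.
  by have := integrableD measurableT (iF p) i1.
under eq_integral do rewrite big_cons EFinD.
by rewrite integralD_EFin// F0 e1 adde0.
Qed.

(** The integrand is linear in v, so v is split into pieces [rho p * v], each of class C^1 and
    supported in one chart. *)
Lemma green_formula u v (K : set M) : Ck_fun 2 u -> Ck_fun 1 v -> compact K ->
  supported_in K v ->
  (\int[dvol]_x (laplacian g u x * v x + grad_inner g u v x)%:E = 0)%E.
Proof.
move=> u2 v1 cK Kv; have [s [rho [KK [Hrho sum1]]]] := partition_of_unity cK.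
pose vp p x := rho p x * v x.
have vp1 p : Ck_fun 1 (vp p).
  move=> c ac; have [r1 _ _ _] := Hrho p.
  by apply: CkM; [exact: chart_img_open|exact: r1|exact: v1].
have vpK p : supported_in (KK p) (vp p).
  by have [_ _ _ r4] := Hrho p; move=> x /r4 e; rewrite /vp e mul0r.
have vE : v = fun x => \sum_(p <- s) vp p x.
  apply/funext => x; rewrite -mulr_suml.
  have [Kx|nKx] := pselect (K x); first by rewrite sum1// mul1r.
  by rewrite Kv// mulr0.
have E x : laplacian g u x * v x + grad_inner g u v x =
    \sum_(p <- s) green_term g (chart_at p) u (vp p) x.
  have -> : grad_inner g u v x = \sum_(p <- s) grad_inner g u (vp p) x.
    rewrite {1}vE.
    exact: (grad_chart_sum u s (chart_at_atlas x) (chart_img_mem (chart_at_dom x)) vp1).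
  rewrite {1}vE mulr_sumr -big_split; apply: eq_bigr => p _ /=.
  have [_ k1 k2 _] := Hrho p.
  exact: (green_termE x (chart_at_atlas p) u2 (vp1 p) k1 k2 (vpK p)).
under eq_integral do rewrite E.
apply: integral_sum0 => p; have [_ k1 k2 _] := Hrho p.
  apply: (compact_integrable hdvol k1).
    exact: (green_term_continuous (chart_at_atlas p) u2 (vp1 p) k1 k2 (vpK p)).
  exact: green_term_supported k1 (vpK p).
exact: (chart_green hdvol (chart_at_atlas p) u2 (vp1 p) k1 k2 (vpK p)).
Qed.

(** Around a point off K the function u vanishes, hence so do its partial derivatives and the
    flux. *)
Lemma laplacian_supported u (K : set M) : compact K -> supported_in K u ->
  supported_in K (laplacian g u).
Proof.
move=> cK Ku x nK; have cx := chart_img_mem (chart_at_dom x).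
rewrite [LHS]/(lap_chart g (chart_at x) u (chart_at x x)) /lap_chart.
rewrite big1 ?mulr0// => i _; rewrite -(partial_cst i 0 (chart_at x x)).
apply: near_eq_derive.
have : \forall y \near chart_at x x, (u \o chart_inv (chart_at x)) y = 0.
  apply: (@chart_inv_near _ _ _ (chart_at x) (chart_at x x) (fun x => u x = 0)) => //.
  by rewrite chart_mapK//; [exact: supported_near nK|exact: chart_at_dom].
move=> H; have {}H j : \forall y \near chart_at x x,
    partial j (u \o chart_inv (chart_at x)) y = partial j (fun=> 0) y.
  exact: near_partial H.
have := filter_forall (@nbhs_filter V (chart_at x x)) H.
apply: filterS => y Hy; rewrite /flux big1 ?mulr0// => j _.
by rewrite Hy partial_cst mulr0.
Qed.

(** Green's formula for (u, v) and for (v, u) contains the same gradient integral, by symmetry of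
    the metric. It is finite because v has compact support, so it can be cancelled in the extended
    reals. *)
Lemma laplacian_self_adjoint u v : smooth_fun u -> compactly_supported u ->
  smooth_fun v -> compactly_supported v ->
  (\int[dvol]_x (laplacian g u x * v x)%:E = \int[dvol]_x (u x * laplacian g v x)%:E)%E.
Proof.
move=> /smooth_funP su /compactly_supportedP[K cK Ku].
move=> /smooth_funP sv /compactly_supportedP[L cL Lv].
pose A x := laplacian g u x * v x; pose B x := u x * laplacian g v x.
pose G x := grad_inner g u v x.
have cont w : (forall m, Ck_fun m w) -> continuous w.
  by move=> sw; exact: (Ck_fun_continuous (sw 0)).
have cA : continuous A.
  move=> x; apply: continuousM; last exact: cont.
  exact: (Ck_fun_continuous (laplacian_Ck (su 2))).
have cB : continuous B.
  move=> x; apply: continuousM; first exact: cont.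
  exact: (Ck_fun_continuous (laplacian_Ck (sv 2))).
have cG : continuous G := Ck_fun_continuous (grad_inner_Ck (su 1) (sv 1)).
have iA : dvol.-integrable setT (EFin \o A).
  by apply: (compact_integrable hdvol cL cA) => x /Lv e; rewrite /A e mulr0.
have iB : dvol.-integrable setT (EFin \o B).
  by apply: (compact_integrable hdvol cK cB) => x /Ku e; rewrite /B e mul0r.
have iG : dvol.-integrable setT (EFin \o G).
  apply: (compact_integrable hdvol cL cG) => x nL.
  exact: (grad_chart_out g u cL Lv nL (chart_at_dom x)).
have GA := green_formula (su 2) (sv 1) cL Lv.
have GB := green_formula (sv 2) (su 1) cK Ku.
have EA : (\int[dvol]_x (A x)%:E + \int[dvol]_x (G x)%:E = 0)%E.
  by rewrite -(integralD_EFin measurableT iA iG); exact: GA.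
have EB : (\int[dvol]_x (B x)%:E + \int[dvol]_x (G x)%:E = 0)%E.
  rewrite -(integralD_EFin measurableT iB iG) -[RHS]GB; apply: eq_integral => x _.
  rewrite -EFinD /B /G mulrC; congr ((_ + _)%:E).
  exact: (grad_chart_sym g u v (chart_at_atlas x) (chart_img_mem (chart_at_dom x))).
have fG : (\int[dvol]_x (G x)%:E \is a fin_num)%E := integrable_fin_num measurableT iG.
have : (\int[dvol]_x (A x)%:E + \int[dvol]_x (G x)%:E =
        \int[dvol]_x (B x)%:E + \int[dvol]_x (G x)%:E)%E by rewrite EA EB.
move/(congr1 (fun t => t - \int[dvol]_x (G x)%:E)%E); rewrite (addeK _ fG) (addeK _ fG); exact.
Qed.

Lemma iter_laplacian_smooth k u : smooth_fun u -> smooth_fun (iter k (laplacian g) u).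
Proof. by move=> su; elim: k => [//|k IH]; rewrite iterS; exact: laplacian_smooth. Qed.

Lemma laplacian_compactly_supported u : compactly_supported u ->
  compactly_supported (laplacian g u).
Proof.
move=> /compactly_supportedP[K cK Ku]; apply/compactly_supportedP; exists K => //.
exact: laplacian_supported.
Qed.

(** The factors move one at a time; v varies in the induction because it is replaced by its
    Laplacian. *)
Lemma iter_laplacian_self_adjoint k u v : smooth_fun u -> compactly_supported u ->
  smooth_fun v -> compactly_supported v ->
  (\int[dvol]_x (iter k (laplacian g) u x * v x)%:E =
   \int[dvol]_x (u x * iter k (laplacian g) v x)%:E)%E.
Proof.
move=> su cu; elim: k v => [//|k IH] v sv cv.
rewrite [in RHS]iterSr iterS.
have cuk : compactly_supported (iter k (laplacian g) u).
  elim: k {IH} => [//|k IH]; rewrite iterS; exact: laplacian_compactly_supported.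
rewrite -IH; [|exact: laplacian_smooth|exact: laplacian_compactly_supported].
exact: laplacian_self_adjoint (iter_laplacian_smooth k su) cuk sv cv.
Qed.

End Laplacian.

(** * Differential operators *)

Section Partials.
Variables (R : realType) (n : nat) (U : set 'rV[R]_n).
Hypothesis oU : open U.
Implicit Types (f h : 'rV[R]_n -> R).

Lemma Ck_partials m s f : (forall m, Ck m U f) -> Ck m U (partials s f).
Proof. by move=> sf; elim: s m => [|i s IH] m; [exact: sf|exact: Ck_partial]. Qed.

Lemma partialsB s f h y : (forall m, Ck m U f) -> (forall m, Ck m U h) -> U y ->
  partials s (fun z => f z - h z) y = partials s f y - partials s h y.
Proof.
move=> sf sh; elim: s y => [//|i s IH] y Uy /=.
rewrite (partial_ext i oU Uy IH) /partial.
apply: (@deriveB R _ _ (partials s f) (partials s h) y).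
  exact: (@Ck_derivable _ _ 0 _ _ _ i (Ck_partials 1 s sf) Uy).
exact: (@Ck_derivable _ _ 0 _ _ _ i (Ck_partials 1 s sh) Uy).
Qed.

End Partials.

Section DifferentialOperators.
Variables (R : realType) (n : nat) (M : smooth_manifold R n).
Local Notation V := 'rV[R]_n.
Implicit Types (c : chart R n M) (u v f : M -> R) (m : nat).

(** The finite index type is arbitrary and words may repeat, so that sums and Leibniz rules become
    disjoint unions of index types; terms are collected word by word only in
    [local_diffop_expand]. *)
Definition local_diffop c m (S : (M -> R) -> V -> R) : Prop :=
  exists (I : finType) (a : I -> V -> R) (s : I -> seq 'I_n),
    [/\ forall i k, Ck k (chart_img c) (a i), forall i, (size (s i) < m)%N &
    forall u, smooth_fun u -> forall y, chart_img c y ->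
      S u y = \sum_i a i y * partials (s i) (u \o chart_inv c) y].

Definition diffop_lt m (T : (M -> R) -> M -> R) : Prop :=
  forall c, atlas c -> local_diffop c m (fun u => T u \o chart_inv c).

Section OneChart.
Variable c : chart R n M.
Hypothesis ac : atlas c.
Let oc : open (chart_img c) := @chart_img_open _ _ _ c.
Implicit Types (S : (M -> R) -> V -> R).

Lemma local_diffop_ext m S S' : (forall u, smooth_fun u -> forall y, chart_img c y ->
    S u y = S' u y) -> local_diffop c m S -> local_diffop c m S'.
Proof.
move=> SS' [I [a [s [sa ss E]]]]; exists I, a, s; split => // u su y cy.
by rewrite -SS'// E.
Qed.

Lemma local_diffop_le m m' S : (m <= m')%N -> local_diffop c m S -> local_diffop c m' S.
Proof.
move=> mm' [I [a [s [sa ss E]]]]; exists I, a, s; split => // i.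
exact: leq_trans (ss i) mm'.
Qed.

Lemma local_diffop0 m : local_diffop c m (fun _ _ => 0).
Proof.
exists void, (fun _ _ => 0), (fun _ => [::]).
by split=> [[]|[]|u _ y _]; rewrite big1// => -[].
Qed.

Lemma local_diffop_id : local_diffop c 1 (fun u => u \o chart_inv c).
Proof.
exists unit, (fun _ _ => 1), (fun _ => [::]).
split=> [_ k|//|u _ y _]; first exact: Ck_cst.
by rewrite (bigD1 tt)//= big1 ?addr0 ?mul1r// => -[].
Qed.

Lemma local_diffopD m S S' : local_diffop c m S -> local_diffop c m S' ->
  local_diffop c m (fun u y => S u y + S' u y).
Proof.
move=> [I [a [s [sa ss E]]]] [I' [a' [s' [sa' ss' E']]]].
exists (I + I')%type, (fun i => match i with inl i => a i | inr i => a' i end),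
  (fun i => match i with inl i => s i | inr i => s' i end).
split=> [[i|i]|[i|i]|u su y cy]; rewrite ?sa ?sa' ?ss ?ss'//.
by rewrite big_sumType /= E// E'.
Qed.

Lemma local_diffopM m S (b : V -> R) : (forall k, Ck k (chart_img c) b) ->
  local_diffop c m S -> local_diffop c m (fun u y => b y * S u y).
Proof.
move=> sb [I [a [s [sa ss E]]]]; exists I, (fun i y => b y * a i y), s.
split=> // [i k|u su y cy]; first exact: CkM.
by rewrite E// mulr_sumr; apply: eq_bigr => i _; rewrite mulrA.
Qed.

Lemma local_diffop_sum m (J : Type) (r : seq J) (S : J -> (M -> R) -> V -> R) :
  (forall j, local_diffop c m (S j)) ->
  local_diffop c m (fun u y => \sum_(j <- r) S j u y).
Proof.
move=> HS; elim: r => [|j r IH].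
  apply: local_diffop_ext (local_diffop0 m) => u _ y _.
  by rewrite big_nil.
apply: local_diffop_ext (local_diffopD (HS j) IH) => u _ y _.
by rewrite big_cons.
Qed.

Lemma local_diffop_partial m S i : local_diffop c m S ->
  local_diffop c m.+1 (fun u => partial i (S u)).
Proof.
move=> [I [a [s [sa ss E]]]].
(* Leibniz: one copy of I differentiates the function, the other the coefficient. *)
exists (I + I)%type, (fun j => match j with inl j => a j | inr j => partial i (a j) end),
  (fun j => match j with inl j => i :: s j | inr j => s j end).
split=> [[j|j] k|[j|j]|u su y cy].
- exact: sa.
- exact/Ck_partial/sa.
- by rewrite /= ltnS.
- exact: leq_trans (ss j) _.
have sm k : Ck k (chart_img c) (u \o chart_inv c) := (smooth_funP u).1 su k c ac.
rewrite (partial_ext i oc cy (E u su)) big_sumType /= -big_split /=.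
have da j : derivable (a j) y (basis_vec R i).
  exact: (@Ck_derivable _ _ 0 _ _ _ i (sa j 1) cy).
have dp j : derivable (partials (s j) (u \o chart_inv c)) y (basis_vec R i).
  exact: (@Ck_derivable _ _ 0 _ _ _ i (Ck_partials 1 (s j) sm) cy).
have [_ ->] := @partial_sum R n I (index_enum I)
  (fun j z => a j z * partials (s j) (u \o chart_inv c) z) i y
  (fun j => derivableM (da j) (dp j)).
apply: eq_bigr => j _; rewrite (partialM (da j) (dp j)); congr (_ + _).
exact: mulrC.
Qed.

Lemma local_diffop_partials m S s : local_diffop c m S ->
  local_diffop c (size s + m) (fun u => partials s (S u)).
Proof.
by move=> HS; elim: s => [//|i s IH]; exact: local_diffop_partial IH.
Qed.

Lemma local_diffop_smooth m S u k : local_diffop c m S -> smooth_fun u ->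
  Ck k (chart_img c) (S u).
Proof.
move=> [I [a [s [sa ss E]]]] su.
have sm j : Ck j (chart_img c) (u \o chart_inv c) := (smooth_funP u).1 su j c ac.
apply: (Ck_ext oc (fun y cy => esym (E u su y cy))).
apply: Ck_sum => // i _; apply: CkM => //; exact: Ck_partials.
Qed.

(** Coefficients with the same word are added up; each index i then contributes exactly once, at the
    length and the tuple given by [s i]. *)
Lemma local_diffop_expand m S : local_diffop c m S ->
  exists a : seq 'I_n -> V -> R,
    (forall s, smooth_on (chart_img c) (a s)) /\
    forall u, smooth_fun u -> forall y, chart_img c y ->
      S u y = \sum_(j < m) \sum_(s : j.-tuple 'I_n) a s y * partials s (u \o chart_inv c) y.
Proof.
move=> [I [a [s [sa ss E]]]].
exists (fun t y => \sum_(i | s i == t) a i y); split=> [t|u su y cy].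
  by apply/smooth_onP => k; apply: Ck_sum => // i _; exact: sa.
rewrite E//.
transitivity (\sum_(j < m) \sum_(t : j.-tuple 'I_n) \sum_i
    (if s i == t then a i y * partials (s i) (u \o chart_inv c) y else 0)).
  have -> : \sum_(j < m) \sum_(t : j.-tuple 'I_n) \sum_i
    (if s i == t then a i y * partials (s i) (u \o chart_inv c) y else 0) =
    \sum_i \sum_(j < m) \sum_(t : j.-tuple 'I_n)
    (if s i == t then a i y * partials (s i) (u \o chart_inv c) y else 0).
    rewrite [RHS]exchange_big; apply: eq_bigr => j _.
    by rewrite [RHS]exchange_big.
  apply: eq_bigr => i _; rewrite (bigD1 (Ordinal (ss i)))//= [X in _ + X]big1 ?addr0.
    rewrite (bigD1 (in_tuple (s i)))//= eqxx big1 ?addr0// => t.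
    by rewrite -val_eqE /= eq_sym => /negPf ->.
  move=> j ji; apply: big1 => t _; case: eqP => // st; exfalso.
  by move: ji; rewrite -val_eqE /= st size_tuple eqxx.
apply: eq_bigr => j _; apply: eq_bigr => t _.
rewrite mulr_suml [RHS]big_mkcond; apply: eq_bigr => i _.
by case: eqP => // ->.
Qed.

End OneChart.

Lemma diffop_lt_order m (T : (M -> R) -> M -> R) : diffop_lt m T -> diffop_order_lt m T.
Proof. by move=> HT c ac; exact: (local_diffop_expand (HT c ac)). Qed.

Lemma diffop_lt_smooth m T u : diffop_lt m T -> smooth_fun u -> smooth_fun (T u).
Proof.
move=> HT su; apply/smooth_funP => k c ac.
exact: (local_diffop_smooth ac k (HT c ac) su).
Qed.

Lemma diffop_lt_ext m T T' : (forall u, smooth_fun u -> forall x, T u x = T' u x) ->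
  diffop_lt m T -> diffop_lt m T'.
Proof.
move=> TT' HT c ac; apply: local_diffop_ext (HT c ac) => u su y cy.
exact: TT'.
Qed.

Lemma diffop_lt_le m m' T : (m <= m')%N -> diffop_lt m T -> diffop_lt m' T.
Proof. by move=> mm' HT c ac; exact: local_diffop_le mm' (HT c ac). Qed.

Lemma diffop_lt_id : diffop_lt 1 id.
Proof. by move=> c ac; exact: local_diffop_id. Qed.

Lemma diffop_ltD m T T' : diffop_lt m T -> diffop_lt m T' ->
  diffop_lt m (fun u x => T u x + T' u x).
Proof. by move=> HT HT' c ac; exact: (local_diffopD (HT c ac) (HT' c ac)). Qed.

Lemma diffop_ltM m T f : smooth_fun f -> diffop_lt m T ->
  diffop_lt m (fun u x => f x * T u x).
Proof.
move=> sf HT c ac; apply: (local_diffopM _ (HT c ac)) => k.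
exact: (smooth_funP f).1 sf k c ac.
Qed.

(** Strict bounds do not add: T of order at most m after T' of order below m' has order below m +
    m', whence [m.+1] on one side. *)
Lemma diffop_lt_comp m m' T T' : diffop_lt m.+1 T -> diffop_lt m' T' ->
  diffop_lt (m + m') (fun u => T (T' u)).
Proof.
move=> HT HT' c ac; have [I [a [s [sa ss E]]]] := HT c ac.
apply: (@local_diffop_ext c _ (fun u y => \sum_i a i y *
    partials (s i) (T' u \o chart_inv c) y)).
  by move=> u su y cy; rewrite /= -E//; exact: diffop_lt_smooth HT' su.
apply: local_diffop_sum => i; apply: (local_diffopM (sa i)).
apply: (@local_diffop_le c (size (s i) + m')); last exact: local_diffop_partials (HT' c ac).
by rewrite leq_add2r -ltnS.
Qed.

(** T is an arbitrary map on functions; its additivity on smooth ones is read off from the local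
    formula around x. *)
Lemma diffop_ltB m T u v : diffop_lt m T -> smooth_fun u -> smooth_fun v ->
  forall x, T (fun x => u x - v x) x = T u x - T v x.
Proof.
move=> HT su sv x; have ac := chart_at_atlas x; have cx := chart_img_mem (chart_at_dom x).
have [I [a [s [sa ss E]]]] := HT _ ac.
have suv : smooth_fun (fun x => u x - v x).
  apply/smooth_funP => k c ac'; apply: CkB; first exact: chart_img_open.
    exact: (smooth_funP u).1 su k c ac'.
  exact: (smooth_funP v).1 sv k c ac'.
have F w : smooth_fun w -> T w x = \sum_i a i (chart_at x x) *
    partials (s i) (w \o chart_inv (chart_at x)) (chart_at x x).
  by move=> sw; rewrite -(E w sw _ cx) /= chart_mapK//; exact: chart_at_dom.
rewrite !F// -sumrB; apply: eq_bigr => i _; rewrite -mulrBr; congr (_ * _).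
apply: (partialsB (@chart_img_open _ _ _ (chart_at x)) (s i) _ _ cx) => k.
  exact: (smooth_funP u).1 su k _ ac.
exact: (smooth_funP v).1 sv k _ ac.
Qed.

(* Induct with B^(k+1) - A^(k+1) = A (B^k - A^k) + q B^k. *)
Lemma iter_perturbation (A B : (M -> R) -> M -> R) (q : M -> R) k :
  diffop_lt 3 A -> smooth_fun q ->
  (forall u, smooth_fun u -> forall x, B u x = A u x + q x * u x) ->
  diffop_lt (2 * k) (fun u x => iter k B u x - iter k A u x).
Proof.
move=> HA sq BE.
have HB : diffop_lt 3 B.
  apply: (@diffop_lt_ext _ (fun u x => A u x + q x * u x)) => [u su x|].
    by rewrite BE.
  apply: (diffop_ltD HA); apply: (diffop_ltM sq).
  exact: diffop_lt_le diffop_lt_id.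
have HBk j : diffop_lt (2 * j).+1 (iter j B).
  elim: j => [|j IH]; first exact: diffop_lt_id.
  by have := diffop_lt_comp HB IH; rewrite mulnS addnS.
have HAk j : diffop_lt (2 * j).+1 (iter j A).
  elim: j => [|j IH]; first exact: diffop_lt_id.
  by have := diffop_lt_comp HA IH; rewrite mulnS addnS.
elim: k => [|k IH].
  move=> c ac; apply: local_diffop_ext (local_diffop0 c _) => u _ y _.
  by rewrite /= subrr.
apply: (@diffop_lt_ext _ (fun u x => A (fun x => iter k B u x - iter k A u x) x +
    q x * iter k B u x)) => [u su x|].
  have sB : smooth_fun (iter k B u) by exact: diffop_lt_smooth (HBk k) su.
  have sA : smooth_fun (iter k A u) by exact: diffop_lt_smooth (HAk k) su.
  by rewrite (diffop_ltB HA sB sA) !iterS BE// addrAC.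
(* A raises the bound 2k of the difference by 2, and q B^k has order at most 2k, below 2k + 2. *)
rewrite mulnS; apply: diffop_ltD; first exact: (diffop_lt_comp HA IH).
by apply: (diffop_ltM sq); apply: diffop_lt_le (HBk k).
Qed.

End DifferentialOperators.

(** * Conjugation by half-densities *)

Section WeightedLaplacian.
Variables (R : realType) (n : nat) (M : smooth_manifold R n).
Variable g : riemannian_metric M.
Variable dvol : {measure set (borel M) -> \bar R}.
Hypothesis hdvol : is_riemannian_volume g dvol.
Local Notation V := 'rV[R]_n.
Implicit Types (c : chart R n M) (x : M) (y : V) (u v f psi : M -> R).

Lemma smooth_funM u v : smooth_fun u -> smooth_fun v -> smooth_fun (fun x => u x * v x).
Proof.
move=> /smooth_funP su /smooth_funP sv; apply/smooth_funP => m c ac.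
by apply: CkM; [exact: chart_img_open|exact: su|exact: sv].
Qed.

Lemma smooth_fun_expR (a : R) psi : smooth_fun psi ->
  smooth_fun (fun x => expR (a * psi x)).
Proof.
move=> /smooth_funP sp; apply/smooth_funP => m c ac.
have oc := @chart_img_open _ _ _ c.
by apply: Ck_expR => //; apply: CkM => //; [exact: Ck_cst|exact: sp].
Qed.

Lemma local_flux_diffop c i : atlas c -> local_diffop c 2 (fun u => flux g c u i).
Proof.
move=> ac; apply: local_diffopM; first by move=> k; exact: vol_density_Ck.
apply: local_diffop_sum => j; apply: local_diffopM.
  by move=> k; exact: gram_inv_Ck.
by apply: local_diffop_partial => //; exact: local_diffop_id.
Qed.

Lemma laplacian_diffop : diffop_lt 3 (laplacian g).
Proof.
move=> c ac; apply: (@local_diffop_ext _ _ _ c _ (lap_chart g c)).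
  move=> u su y cy /=.
  rewrite (laplacianE hdvol ac (chart_inv_dom cy)) ?chart_invK//.
  exact: (smooth_funP u).1 su 2.
apply: local_diffopM.
  move=> k; apply: Ck_inv; [exact: chart_img_open| |exact: vol_density_Ck].
  by move=> y cy; rewrite gt_eqF// vol_density_gt0.
apply: local_diffop_sum => i; apply: local_diffop_partial => //.
exact: local_flux_diffop.
Qed.

Lemma grad_inner_diffop psi : smooth_fun psi -> diffop_lt 2 (grad_inner g psi).
Proof.
move=> sp c ac; apply: (@local_diffop_ext _ _ _ c _ (grad_chart g c psi)).
  move=> u su y cy /=.
  rewrite (grad_innerE g ac (chart_inv_dom cy)) ?chart_invK//.
    exact: (smooth_funP psi).1 sp 1.
  exact: (smooth_funP u).1 su 1.
apply: local_diffop_sum => i; apply: local_diffop_sum => j; apply: local_diffopM.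
  move=> k; apply: CkM; [exact: chart_img_open|exact: gram_inv_Ck|].
  exact: Ck_partial ((smooth_funP psi).1 sp k.+1 c ac).
by apply: local_diffop_partial => //; exact: local_diffop_id.
Qed.

Lemma weighted_laplacian_diffop psi : smooth_fun psi ->
  diffop_lt 3 (weighted_laplacian g psi).
Proof.
move=> sp; apply: (@diffop_lt_ext _ _ _ _
    (fun u x => laplacian g u x + -1 * grad_inner g psi u x)).
  by move=> u su x; rewrite mulN1r.
apply: (diffop_ltD laplacian_diffop); apply: diffop_ltM.
  by apply/smooth_funP => m c ac; exact: Ck_cst.
by apply: diffop_lt_le (grad_inner_diffop sp).
Qed.

Lemma flux_mul c f u i y : atlas c -> chart_img c y -> smooth_fun f -> smooth_fun u ->
  flux g c (fun x => f x * u x) i y =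
  f (chart_inv c y) * flux g c u i y + u (chart_inv c y) * flux g c f i y.
Proof.
move=> ac cy sf su.
have df j := @Ck_derivable _ _ 0 _ _ _ j ((smooth_funP f).1 sf 1 c ac) cy.
have du j := @Ck_derivable _ _ 0 _ _ _ j ((smooth_funP u).1 su 1 c ac) cy.
rewrite /flux !mulrA ![_ (chart_inv c y) * vol_density _ _ _]mulrC -!mulrA -mulrDr.
congr (_ * _); rewrite !mulr_sumr -big_split; apply: eq_bigr => j _ /=.
have -> : partial j ((fun x => f x * u x) \o chart_inv c) y =
    f (chart_inv c y) * partial j (u \o chart_inv c) y +
    u (chart_inv c y) * partial j (f \o chart_inv c) y := partialM (df j) (du j).
ring.
Qed.

(** Differentiating the two summands of [flux_mul] leaves two cross terms, which coincide by
    symmetry of the metric and give the factor 2. *)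
Lemma lap_chart_mul c f u y : atlas c -> chart_img c y -> smooth_fun f -> smooth_fun u ->
  lap_chart g c (fun x => f x * u x) y =
  f (chart_inv c y) * lap_chart g c u y + u (chart_inv c y) * lap_chart g c f y +
  2 * grad_chart g c f u y.
Proof.
move=> ac cy sf su; have oc := @chart_img_open _ _ _ c.
pose F := f \o chart_inv c; pose W := u \o chart_inv c.
have dF j := @Ck_derivable _ _ 0 _ _ _ j ((smooth_funP f).1 sf 1 c ac) cy.
have dW j := @Ck_derivable _ _ 0 _ _ _ j ((smooth_funP u).1 su 1 c ac) cy.
have dfF i j := @Ck_derivable _ _ 0 _ _ _ j
  (flux_Ck g i ac ((smooth_funP f).1 sf 2)) cy.
have dfW i j := @Ck_derivable _ _ 0 _ _ _ j
  (flux_Ck g i ac ((smooth_funP u).1 su 2)) cy.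
have E i : partial i (flux g c (fun x => f x * u x) i) y =
    (F y * partial i (flux g c u i) y + W y * partial i (flux g c f i) y) +
    (flux g c u i y * partial i F y + flux g c f i y * partial i W y).
  transitivity (partial i (fun z => F z * flux g c u i z + W z * flux g c f i z) y).
    by apply: (partial_ext i oc cy) => z cz; exact: flux_mul.
  have d1 := derivableM (dF i) (dfW i i).
  have d2 := derivableM (dW i) (dfF i i).
  rewrite (partialD d1 d2) (partialM (dF i) (dfW i i)) (partialM (dW i) (dfF i i)).
  exact: addrACA.
have v0 : vol_density g c y != 0 by rewrite gt_eqF// vol_density_gt0.
have G (a b : M -> R) : (vol_density g c y)^-1 *
    \sum_i flux g c a i y * partial i (b \o chart_inv c) y = grad_chart g c b a y.
  rewrite /grad_chart mulr_sumr; apply: eq_bigr => i _.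
  rewrite /flux -!mulrA mulKf// mulr_suml; apply: eq_bigr => j _.
  by rewrite mulrAC.
have key (vi f' w a b s1 s2 G0 : R) : vi * s1 = G0 -> vi * s2 = G0 ->
    vi * (f' * a + w * b + (s1 + s2)) = f' * (vi * a) + w * (vi * b) + 2 * G0.
  by move=> e1 e2; rewrite mulr_natl mulr2n -{1}e1 -e2; ring.
rewrite -(key _ _ _ _ _ _ _ _ (G u f) (etrans (G f u) (grad_chart_sym g u f ac cy))).
rewrite /(lap_chart _ _ (fun x => f x * u x)); congr (_ * _).
transitivity (\sum_i ((F y * partial i (flux g c u i) y + W y * partial i (flux g c f i) y) +
    (flux g c u i y * partial i F y + flux g c f i y * partial i W y))).
  apply: eq_bigr => i _.
  exact: E.
rewrite [LHS]big_split.
congr (_ + _); last by rewrite [LHS]big_split.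
by rewrite [LHS]big_split !mulr_sumr.
Qed.

Lemma partial_expR (a : R) (h : V -> R) i y : derivable h y (basis_vec R i) ->
  partial i (fun z => expR (a * h z)) y = a * expR (a * h y) * partial i h y.
Proof.
move=> dh.
have dah : derivable (fun z => a * h z) y (basis_vec R i).
  exact: (derivableM (@derivable_cst _ _ _ a y (basis_vec R i)) dh).
have [_ D] := is_derive_comp1 dah (is_derive_expR (a * h y)).
rewrite /partial [LHS]D -/(partial i (fun z => a * h z) y).
rewrite (@partialM _ _ i (fun=> a) h y (@derivable_cst _ _ _ a y _) dh) partial_cst mulr0 addr0.
by rewrite mulrA [_ * a]mulrC.
Qed.

Lemma grad_inner_expR (a : R) psi u x : smooth_fun psi ->
  grad_inner g (fun x => expR (a * psi x)) u x =
  a * expR (a * psi x) * grad_inner g psi u x.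
Proof.
move=> sp; have ac := chart_at_atlas x; have cx := chart_img_mem (chart_at_dom x).
rewrite /grad_inner mulr_sumr; apply: eq_bigr => i _.
rewrite mulr_sumr; apply: eq_bigr => j _.
have dp := @Ck_derivable _ _ 0 _ _ _ i ((smooth_funP psi).1 sp 1 _ ac) cx.
have -> : partial i ((fun x => expR (a * psi x)) \o chart_inv (chart_at x)) (chart_at x x) =
  a * expR (a * psi x) * partial i (psi \o chart_inv (chart_at x)) (chart_at x x).
  rewrite [LHS](@partial_expR a (psi \o chart_inv (chart_at x)) i _ dp) /=.
  by rewrite chart_mapK//; exact: chart_at_dom.
ring.
Qed.

Lemma laplacian_mul f u x : smooth_fun f -> smooth_fun u ->
  laplacian g (fun x => f x * u x) x =
  f x * laplacian g u x + u x * laplacian g f x + 2 * grad_inner g f u x.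
Proof.
move=> sf su; have dx := chart_at_dom x.
have := lap_chart_mul (chart_at_atlas x) (chart_img_mem dx) sf su.
by rewrite (chart_mapK dx).
Qed.

Definition half_conjugate psi (T : (M -> R) -> M -> R) u : M -> R :=
  fun x => expR (2^-1 * psi x) * T (fun x => expR (- 2^-1 * psi x) * u x) x.

Lemma half_expK psi x : expR (2^-1 * psi x) * expR (- 2^-1 * psi x) = 1.
Proof. by rewrite -expRD mulNr subrr expR0. Qed.

(** The factor 2 of the cross term meets the exponent -1/2, so the first-order part is exactly the
    drift [- grad_inner g psi u]. The rest multiplies u by the value of the conjugated operator on
    the constant 1. *)
Lemma half_conjugate_laplacian psi u x : smooth_fun psi -> smooth_fun u ->
  half_conjugate psi (laplacian g) u x = weighted_laplacian g psi u x +
    half_conjugate psi (laplacian g) (fun=> 1) x * u x.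
Proof.
move=> sp su; have se := smooth_fun_expR (- 2^-1) sp.
rewrite /half_conjugate laplacian_mul// grad_inner_expR//.
have -> : (fun x => expR (- 2^-1 * psi x) * 1) = (fun x => expR (- 2^-1 * psi x)).
  by apply/funext => z; rewrite mulr1.
rewrite /weighted_laplacian.
have := half_expK psi x; set a := expR _; set b := expR _ => ab.
set A := laplacian g u x; set B := laplacian g _ x; set G := grad_inner _ _ _ _.
have -> : a * (b * A + u x * B + 2 * (- 2^-1 * b * G)) =
  (a * b) * A + a * B * u x - (a * b) * G by field.
by rewrite ab !mul1r addrAC.
Qed.

Lemma half_conjugate_smooth psi (T : (M -> R) -> M -> R) u :
  (forall v, smooth_fun v -> smooth_fun (T v)) -> smooth_fun psi -> smooth_fun u ->
  smooth_fun (half_conjugate psi T u).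
Proof.
move=> sT sp su; apply: (smooth_funM (smooth_fun_expR _ sp)); apply: sT.
exact: (smooth_funM (smooth_fun_expR _ sp) su).
Qed.

(** The inner exponentials cancel, so conjugation respects composition and powers. *)
Lemma half_conjugate_comp psi (T S : (M -> R) -> M -> R) u :
  half_conjugate psi T (half_conjugate psi S u) = half_conjugate psi (T \o S) u.
Proof.
apply/funext => x; rewrite /half_conjugate /=; congr (_ * T _ x).
by apply/funext => z; rewrite mulrA [X in X * _]mulrC half_expK mul1r.
Qed.

Lemma iter_half_conjugate psi (T : (M -> R) -> M -> R) k u :
  half_conjugate psi (iter k T) u = iter k (half_conjugate psi T) u.
Proof.
elim: k => [|k IH]; last by rewrite [RHS]iterS -IH half_conjugate_comp.
by apply/funext => x; rewrite /half_conjugate /= mulrA half_expK mul1r.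
Qed.

End WeightedLaplacian.

(** * The conformally invariant operators *)

Theorem theorem1p17 (R : realType) (n : nat) (M : smooth_manifold R n)
    (g : riemannian_metric M)
    (dvol : {measure set (borel M) -> \bar R})
    (hdvol : is_riemannian_volume g dvol)
    (phi : M -> R) (hphi : smooth_fun phi) (k : nat) :
  exists L : density phi (- 2^-1) -> density phi (- 2^-1),
    forall psi : weighted_class phi,
      exists P : (M -> R) -> (M -> R),
        [/\ represents L psi P,
            formally_self_adjoint dvol (val psi) P
          & has_leading_term (2 * k) P
              (iter k (weighted_laplacian g (val psi)))].
Proof.
have smooth_rep (psi : weighted_class phi) : smooth_fun (val psi).
  have [omega so ->] : exists2 omega, smooth_fun omega & val psi = phi \+ omega.
    exact: set_mem (valP psi).
  apply/smooth_funP => m c ac; apply: CkD; first exact: chart_img_open.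
    exact: (smooth_funP phi).1 hphi m c ac.
  exact: (smooth_funP omega).1 so m c ac.
pose P (psi : M -> R) := half_conjugate psi (iter k (laplacian g)).
have P_smooth (psi : weighted_class phi) u : smooth_fun u -> smooth_fun (P (val psi) u).
  move=> su; exact: (half_conjugate_smooth
    (fun w sw => iter_laplacian_smooth hdvol k sw) (smooth_rep psi) su).
(* The function e^(-psi/2) f(psi) is the same for psi and psi', so both sides apply the iterated
   Laplacian to one function and differ by the outer exponential. *)
have P_law (f : density phi (- 2^-1)) (psi psi' : weighted_class phi) (v : M -> R) :
    smooth_fun v -> val psi' = val psi \- v ->
    forall x, P (val psi') (f psi') x = expR (- 2^-1 * v x) * P (val psi) (f psi) x.
  move=> sv E x; rewrite /P /half_conjugate mulrA -expRD E.
  congr (expR _ * iter k (laplacian g) _ x); first by rewrite /= mulrBr mulNr addrC.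
  apply/funext => z; rewrite (density_law f sv E) mulrA -expRD; congr (expR _ * _).
  by rewrite /= mulrBr subrK.
pose L (f : density phi (- 2^-1)) : density phi (- 2^-1) :=
  Density (fun psi => P_smooth psi (f psi) (density_smooth f psi)) (P_law f).
exists L => psi; exists (P (val psi)); split.
- by [].
- move=> u v su cu sv cv.
  pose e x := expR (- 2^-1 * val psi x).
  have se : smooth_fun e := smooth_fun_expR _ (smooth_rep psi).
  have cs w : compactly_supported w -> compactly_supported (fun x => e x * w x).
    move=> /compactly_supportedP[K cK Kw]; apply/compactly_supportedP; exists K => //.
    by move=> x /Kw ->; rewrite mulr0.
  (* The weight e^(-psi) is split into two halves: one cancels the outer factor of the conjugate,
     the other turns the second function into its half-density. *)
  have E (a b x' : R) : expR (2^-1 * x') * a * b * expR (- x') = a * (expR (- 2^-1 * x') * b).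
    have -> : expR (- x') = expR (- 2^-1 * x') * expR (- 2^-1 * x').
      by rewrite -expRD; congr expR; field.
    have : expR (2^-1 * x') * expR (- 2^-1 * x') = 1.
      by rewrite -expRD mulNr subrr expR0.
    set p := expR _; set q := expR _ => pq.
    have -> : p * a * b * (q * q) = (p * q) * (a * (q * b)) by ring.
    by rewrite pq mul1r.
  have := iter_laplacian_self_adjoint hdvol k (smooth_funM se su) (cs u cu)
    (smooth_funM se sv) (cs v cv).
  have -> : (\int[dvol]_x (P (val psi) u x * v x * expR (- val psi x))%:E =
    \int[dvol]_x (iter k (laplacian g) (fun x => e x * u x) x * (e x * v x))%:E)%E.
    by apply: eq_integral => x _; rewrite /P /half_conjugate E.
  have -> : (\int[dvol]_x (u x * P (val psi) v x * expR (- val psi x))%:E =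
    \int[dvol]_x (e x * u x * iter k (laplacian g) (fun x => e x * v x) x)%:E)%E.
    apply: eq_integral => x _; rewrite /P /half_conjugate [u x * _]mulrC E.
    by congr (_%:E); exact: mulrC.
  exact.
apply: diffop_lt_order.
have sP := smooth_rep psi.
apply: (@diffop_lt_ext _ _ _ _ (fun u x =>
  iter k (half_conjugate (val psi) (laplacian g)) u x -
  iter k (weighted_laplacian g (val psi)) u x)).
  by move=> u su x; rewrite /P iter_half_conjugate.
apply: (@iter_perturbation _ _ _ _ _ (half_conjugate (val psi) (laplacian g) (fun=> 1))).
- exact: (weighted_laplacian_diffop hdvol).
- have s1 : smooth_fun (fun _ : M => 1).
    by apply/smooth_funP => m c ac; exact: Ck_cst.
  exact: (half_conjugate_smooth (fun w sw => laplacian_smooth hdvol sw) sP s1).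
- by move=> u su x; exact: half_conjugate_laplacian.
Qed.
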